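(* Let the parameters $\lambda,\xi,d$ and $w_k,v_m,u_m$ ($k\in\mathcal K$, $m\in\mathcal M$) be such that $\lambda\xi<\sum_{m\in\mathcal M}u_mv_m$. Then there exists $\mathbf p=(p_{k,m})_{k\in\mathcal K,m\in\mathcal M}\in[0,1]^{K\times M}$ such that, for any sequence of systems $\{G^N\}_{N\ge1}$ satisfying Condition C with this matrix $\mathbf p$, the queue length process $(X^N_j(t))_{j\in V^N}$ is ergodic for all $N$ large enough. Moreover, such a $\mathbf p$ can be obtained explicitly by solving a set of inequalities.
   Context: Parameters: integers $K,M\ge1$, $d\ge2$; $\mathcal K=\{1,\dots,K\}$, $\mathcal M=\{1,\dots,M\}$; constants $\lambda,\xi,u_m>0$; $w_k\in(0,1)$ with $\sum_kw_k=1$; $v_m\in(0,1)$ with $\sum_mv_m=1$. System: for each $N$, $G^N=(W^N,V^N,E^N)$ is a bipartite graph with dispatchers $W^N=\{1,\dots,W(N)\}$, servers $V^N=\{1,\dots,N\}$, edges $E^N\subseteq W^N\times V^N$, and $W(N)/N\to\xi$. $W^N$ is partitioned into types $W^N_k$ ($k\in\mathcal K$) with $|W^N_k|/W(N)\to w_k$; $V^N$ is partitioned into types $V^N_m$ ($m\in\mathcal M$) with $|V^N_m|/N\to v_m$. Let $\mathcal N^N_w(i)=\{j\in V^N:(i,j)\in E^N\}$, $\delta^N_i=|\mathcal N^N_w(i)|$, $\deg^N_w(i,m)=|\{j\in V^N_m:(i,j)\in E^N\}|$, $\deg^N_v(k,j)=|\{i\in W^N_k:(i,j)\in E^N\}|$.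 Dynamics (local JSQ($d$)): tasks arrive at each dispatcher according to independent Poisson processes of rate $\lambda$. A task arriving at dispatcher $i$ with $\delta^N_i\ge d$ is immediately assigned to the server with the shortest queue among $d$ servers selected uniformly at random from $\mathcal N^N_w(i)$ (ties broken uniformly at random); if $\delta^N_i<d$, it is assigned to a server chosen uniformly at random from $\mathcal N^N_w(i)$. Each server serves its own queue; service times at a type-$m$ server are independent exponential with mean $1/u_m$. $X^N_j(t)$ is the number of tasks (including those in service) at server $j$ at time $t$. Ergodicity refers to the continuous-time Markov chain $(X^N_j(t))_{j\in V^N}$. Condition C (with matrix $\mathbf p$): (a) for each $k,m$, $\lim_{N\to\infty}|\{(i,j)\in W^N_k\times V^N_m:(i,j)\in E^N\}|/(|W^N_k||V^N_m|)=p_{k,m}\in[0,1]$; (b) for each $k,m$, $\lim_{N\to\infty}\frac{\max_{i\in W^N_k}\deg^N_w(i,m)}{\min_{i\in W^N_k}\deg^N_w(i,m)}=1$ and $\lim_{N\to\infty}\frac{\max_{j\in V^N_m}\deg^N_v(k,j)}{\min_{j\in V^N_m}\deg^N_v(k,j)}=1$. *)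

(* Defs.v *)
From HB Require Import structures.
From mathcomp Require Import all_boot all_order all_algebra.
From mathcomp Require Import all_classical all_reals all_analysis.
Set Implicit Arguments.
Unset Strict Implicit.
Unset Printing Implicit Defensive.
Import Order.TTheory GRing.Theory Num.Theory.
Import numFieldNormedType.Exports.
Local Open Scope classical_set_scope.
Local Open Scope ring_scope.

(** * Continuous-time Markov chains on a countable state space *)

Section Markov.
Context {R : realType} {S : countType}.
Implicit Types (q : S -> S -> R) (P : R -> S -> S -> R) (pi : S -> R).

Definition exit_rate q (x : S) : R :=
  fine (\esum_(y in [set y | y != x]) (q x y)%:E).

(** [P] is an honest (stochastic) standard transition function whose Q-matrix
    is the conservative one with off-diagonal entries [q]. When the exit rates
    are bounded, as they are for the queues below, there is exactly one. *)
Record transition_function q P : Prop := TransitionFunction {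
  tf_ge0 : forall t x y, 0 <= t -> 0 <= P t x y;
  tf_sum1 : forall t x, 0 <= t ->
    (\esum_(y in [set: S]) (P t x y)%:E = 1)%E;
  tf_zero : forall x y, P 0 x y = (x == y)%:R;
  tf_semigroup : forall s t x z, 0 <= s -> 0 <= t ->
    ((P (s + t) x z)%:E = \esum_(y in [set: S]) (P s x y * P t y z)%:E)%E;
  tf_rate : forall x y, x != y ->
    P h x y / h @[h --> 0^'+] --> q x y;
  tf_exit_rate : forall x,
    (1 - P h x x) / h @[h --> 0^'+] --> exit_rate q x }.

Definition irreducible P : Prop :=
  forall x y, exists2 t, 0 <= t & 0 < P t x y.

Definition distribution_on pi : Prop :=
  (forall x, 0 <= pi x) /\ (\esum_(x in [set: S]) (pi x)%:E = 1)%E.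

Definition stationary P pi : Prop :=
  forall t y, 0 <= t ->
    (\esum_(x in [set: S]) (pi x * P t x y)%:E = (pi y)%:E)%E.

Definition ergodic_chain q : Prop :=
  exists2 P, transition_function q P &
    irreducible P /\
    exists pi, [/\ distribution_on pi, stationary P pi &
      forall x y, P t x y @[t --> +oo] --> pi y].

End Markov.

(** * The bipartite system and its queue length chain *)

(** Dispatchers are numbered by ['I_(ndisp G)] and servers by ['I_N]; a
    partition into types is a type function, whose fibers are the blocks. *)
Record system (K M N : nat) := System {
  ndisp : nat;
  edge : 'I_ndisp -> 'I_N -> bool;
  dtype : 'I_ndisp -> 'I_K;
  stype : 'I_N -> 'I_M }.

Section System.
Context {K M N : nat}.
Variable G : system K M N.

Definition dispatchers (k : 'I_K) : {set 'I_(ndisp G)} :=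
  [set i | dtype i == k]%SET.
Definition servers (m : 'I_M) : {set 'I_N} := [set j | stype G j == m]%SET.

Definition nbrs (i : 'I_(ndisp G)) : {set 'I_N} := [set j | edge i j]%SET.
Definition delta (i : 'I_(ndisp G)) : nat := #|nbrs i|.

Definition deg_w (i : 'I_(ndisp G)) (m : 'I_M) : nat :=
  #|[set j in servers m | edge i j]%SET|.
Definition deg_v (k : 'I_K) (j : 'I_N) : nat :=
  #|[set i in dispatchers k | edge i j]%SET|.

Definition edges_between (k : 'I_K) (m : 'I_M) : nat :=
  #|[set e : 'I_(ndisp G) * 'I_N
      | [&& e.1 \in dispatchers k, e.2 \in servers m & edge e.1 e.2]]%SET|.

Definition state : countType := {ffun 'I_N -> nat}.

Definition incr (x : state) (j : 'I_N) : state :=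
  [ffun l => (x l + (l == j))%N].
Definition decr (x : state) (j : 'I_N) : state :=
  [ffun l => (x l - (l == j))%N].

Definition shortest (x : state) (A : {set 'I_N}) : {set 'I_N} :=
  [set j in A | [forall l in A, (x j <= x l)%N]]%SET.

Context {R : realType}.

(** Probability that a task arriving at dispatcher [i] in state [x] joins
    server [j]; the [d] servers are sampled without replacement. A dispatcher
    with no neighbour discards its tasks. *)
Definition route (d : nat) (i : 'I_(ndisp G)) (x : state) (j : 'I_N) : R :=
  if (d <= delta i)%N then
    (\sum_(A : {set 'I_N} | (A \subset nbrs i) && (#|A| == d))
        (j \in shortest x A)%:R / #|shortest x A|%:R) / 'C(delta i, d)%:R
  else (j \in nbrs i)%:R / (delta i)%:R.

Definition queue_rate (d : nat) (lambda : R) (u : 'I_M -> R) (x y : state) : R :=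
  \sum_(i < ndisp G) \sum_(j < N | y == incr x j) lambda * route d i x j
  + \sum_(j < N | (0 < x j)%N && (y == decr x j)) u (stype G j).

End System.

(** * Sequences of systems *)

Definition max_over (I : finType) (A : {set I}) (f : I -> nat) : nat :=
  \max_(i in A) f i.
(** The default value [max_over A f] does not affect the minimum of [f] over a
    nonempty [A]. *)
Definition min_over (I : finType) (A : {set I}) (f : I -> nat) : nat :=
  \big[minn/max_over A f]_(i in A) f i.

Section Sequences.
Context {R : realType} {K M : nat}.
Implicit Type G : forall N, system K M N.

(** [G N] for [N = 0] is irrelevant to every asymptotic condition below. *)
Definition type_proportions G (xi : R) (w : 'I_K -> R) (v : 'I_M -> R) : Prop :=
  [/\ (ndisp (G N))%:R / N%:R @[N --> \oo] --> xi,
      forall k, #|dispatchers (G N) k|%:R / (ndisp (G N))%:R @[N --> \oo] --> w k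
    & forall m, #|servers (G N) m|%:R / N%:R @[N --> \oo] --> v m].

(** Since [x / 0 = 0], each ratio limit in [conditionC] equal to 1 forces the
    minimum degree to be nonzero for all large [N]. *)
Definition conditionC G (p : 'M[R]_(K, M)) : Prop :=
  (forall k m,
    (edges_between (G N) k m)%:R
      / (#|dispatchers (G N) k|%:R * #|servers (G N) m|%:R)
      @[N --> \oo] --> p k m) /\
  (forall k m,
    ((max_over (dispatchers (G N) k) (fun i => deg_w i m))%:R
      / (min_over (dispatchers (G N) k) (fun i => deg_w i m))%:R : R)
      @[N --> \oo] --> (1 : R) /\
    ((max_over (servers (G N) m) (fun j => deg_v (G N) k j))%:R
      / (min_over (servers (G N) m) (fun j => deg_v (G N) k j))%:R : R)
      @[N --> \oo] --> (1 : R)).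

Definition unit_entries (p : 'M[R]_(K, M)) : Prop :=
  forall k m, 0 <= p k m <= 1.

Definition eventually_ergodic (d : nat) (lambda xi : R) (w : 'I_K -> R)
    (v u : 'I_M -> R) (p : 'M[R]_(K, M)) : Prop :=
  forall G, type_proportions G xi w v -> conditionC G p ->
    \forall N \near \oo, ergodic_chain (queue_rate (G N) d lambda u).

(** The left-hand side of the second inequality is the limiting arrival rate at
    a type-[m] server if every dispatcher assigned its tasks uniformly at random
    among its neighbours. *)
Definition load_inequalities (lambda xi : R) (w : 'I_K -> R) (v u : 'I_M -> R)
    (p : 'M[R]_(K, M)) : Prop :=
  (forall k, 0 < \sum_(m < M) p k m * v m) /\
  (forall m,
    lambda * xi * \sum_(k < K) w k * p k m / (\sum_(l < M) p k l * v l) < u m).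

End Sequences.

(* Main.v *)
Require Import Defs.
From HB Require Import structures.
From mathcomp Require Import all_boot all_order all_algebra.
From mathcomp Require Import all_classical all_reals all_analysis.
From mathcomp Require Import ring lra.
Set Implicit Arguments.
Unset Strict Implicit.
Unset Printing Implicit Defensive.
Import Order.TTheory GRing.Theory Num.Theory.
Import numFieldNormedType.Exports.
Local Open Scope classical_set_scope.
Local Open Scope ring_scope.

(** Uniform routing, in which every dispatcher hands its tasks to a uniformly
    chosen neighbour, sends tasks to server [j] at rate
    [lambda * \sum_(i | edge i j) (delta i)^-1]. Under condition C the degrees
    are asymptotically constant on each type, so these rates converge, uniformly
    over the servers of type [m], to the left-hand side of the load inequality
    for [m]. Hence for all large [N] every server would be subcritical under
    uniform routing ([eventually_subcritical]). Densities [p k m] proportional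
    to [u m] satisfy the load inequalities, since they give all types of
    servers the same ratio of load to speed ([load_inequalities_solvable]).

    The shortest of [d] sampled queues does at least as well as uniform routing
    in the following sense: for a nondecreasing [f], the mean of [f] over the
    length of the queue joined is at most the mean of [f] over the neighbours
    ([route_mean]), because the minimum of a sample is at most its average.
    With [f n = z ^+ n] and [z > 1] close to [1], the function
    [\sum_j z ^+ x j] therefore has a negative drift proportional to itself, up
    to an additive constant ([lyapunov_drift]). Any state can be reached from
    any other by levelling all queues from below and serving down
    ([accessible_queue]). So a system of fixed size that is subcritical under
    uniform routing is ergodic ([subcritical_ergodic]).

    The link between drift and ergodicity is [foster_lyapunov]. The rates are
    bounded, so the chain is a lazy discrete-time chain run at the jump times
    of a Poisson process, and its transition function is a Poisson mean
    of the powers of a kernel with finitely many moves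
    ([uniformized_transition]). The powers converge geometrically by Harris'
    argument: two independent copies may meet when both are low, and the drift
    brings them down when one of them is high ([harris_contraction]). The
    contraction yields pointwise limits, the drift yields tightness, and
    together they give the invariant distribution ([invariant_distribution]).
    Geometric convergence of the powers becomes exponential convergence in time
    after taking the Poisson mean ([poisson_mean_cvg]). *)

(** * Geometric error terms and nonnegative sums *)

Lemma geometric_le (R : realType) (a b D r : R) : 0 <= r < 1 ->
  (forall n, a <= b + D * r ^+ n) -> a <= b.
Proof.
move=> /andP[r0 r1] H; have rn1 : `|r| < 1 by rewrite ger0_norm.
have cv : b + D * r ^+ n @[n --> \oo] --> b.
  by rewrite -[X in _ --> X]addr0; apply: cvgD; [exact: cvg_cst|exact: cvg_geometric].
by rewrite -(cvg_lim _ cv)//; apply: limr_ge; [apply/cvg_ex; exists b|exact: nearW].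
Qed.

Lemma esum_scale (R : realType) (T : choiceType) (c : R) (f : T -> \bar R) :
  0 <= c -> (forall x, 0 <= f x)%E ->
  (\esum_(x in [set: T]) (c%:E * f x) = c%:E * \esum_(x in [set: T]) f x)%E.
Proof.
move=> c0 f0; rewrite /esum -ereal_supZl//; last first.
  by apply/set0P; eexists; exists set0 => //; exact: fsets_set0.
congr ereal_sup; apply/seteqP; split => [_ [X [fX _] <-]|_ [_ [X [fX _] <-] <-]].
  by exists (\sum_(x \in X) f x)%E; [exists X|rewrite ge0_mule_fsumr].
by exists X => //; rewrite ge0_mule_fsumr.
Qed.

Lemma esum_exchange (R : realType) (T1 T2 : choiceType) (f : T1 -> T2 -> \bar R) :
  (forall x y, 0 <= f x y)%E ->
  (\esum_(x in [set: T1]) \esum_(y in [set: T2]) f x y =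
   \esum_(y in [set: T2]) \esum_(x in [set: T1]) f x y)%E.
Proof.
move=> f0; rewrite !esum_esum//.
rewrite (@reindex_esum _ _ _ ([set: T1] `*`` (fun _ => [set: T2])) _
  (fun k => (k.2, k.1)))//.
split; first by move=> [x y].
  by move=> [x y] [x' y'] _ _ /= [-> ->].
by move=> [x y] _; exists (y, x).
Qed.

Lemma esum_point (R : realType) (T : choiceType) (t : T) (f : T -> R) :
  0 <= f t ->
  (\esum_(x in [set: T]) ((t == x)%:R * f x)%:E = (f t)%:E)%E.
Proof.
move=> ft0; rewrite -(esum_set1 (t := t) (a := fun x => (f x)%:E))//.
rewrite esum_mkcond [RHS]esum_mkcond; apply: eq_esum => x _.
rewrite in_setT in_set1 eq_sym.
by case: eqP => _ /=; rewrite ?mul1r ?mul0r.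
Qed.

Lemma esum_cauchy (R : realType) (f : nat -> nat -> \bar R) :
  (forall n m, 0 <= f n m)%E ->
  (\esum_(n in [set: nat]) \esum_(m in [set: nat]) f n m =
   \esum_(k in [set: nat]) \sum_(n < k.+1) f n (k - n)%N)%E.
Proof.
move=> f0; rewrite esum_esum//.
transitivity (\esum_(k in [set: nat]) \esum_(n in `I_k.+1) f n (k - n)%N)%E; last first.
  apply: eq_esum => k _; rewrite esum_fset//.
  by rewrite -(fsbig_ord _ _ (fun n => f n (k - n)%N)).
rewrite esum_esum//.
rewrite [RHS](@reindex_esum _ _ _ ([set: nat] `*`` (fun _ => [set: nat])) _
  (fun z => ((z.1 + z.2)%N, z.1))) /=.
  by apply: eq_esum => -[n m] _ /=; rewrite addKn.
split.
- by move=> [n m] _ /=; split => //=; exact: leq_addr.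
- move=> [n m] [n' m'] _ _ /= [] e en.
  by move: e; rewrite en => /addnI ->.
- by move=> [k n] /= [_ nk]; exists (n, (k - n)%N) => //=; rewrite subnKC.
Qed.

(** * Means over a Poisson number of steps *)

Section Poisson.
Context {R : realType}.
Implicit Types (s t : R) (g : nat -> R).

Definition poisson_weight t (n : nat) : R := expR (- t) * (t ^+ n / n`!%:R).

Lemma poisson_weight_ge0 t n : 0 <= t -> 0 <= poisson_weight t n.
Proof. by move=> t0; rewrite mulr_ge0 ?expR_ge0// divr_ge0 ?exprn_ge0. Qed.

Lemma esum_exp_coeff t : 0 <= t ->
  (\esum_(n in [set: nat]) (t ^+ n / n`!%:R)%:E = (expR t)%:E)%E.
Proof.
move=> t0; rewrite -nneseries_esumT; last first.
  by move=> n; rewrite lee_fin divr_ge0// exprn_ge0.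
rewrite expRE -EFin_lim; last first.
  rewrite /pseries/=; under eq_fun do rewrite mulrC.
  exact: is_cvg_series_exp_coeff.
apply/congr_lim/funext => n/=; rewrite /pseries/= /series/= -sumEFin//.
by under eq_bigr do rewrite mulrC.
Qed.

(** The generating function of the Poisson law. *)
Lemma esum_poisson_geometric t r : 0 <= t -> 0 <= r ->
  (\esum_(n in [set: nat]) (poisson_weight t n * r ^+ n)%:E
   = (expR (- (t * (1 - r))))%:E)%E.
Proof.
move=> t0 r0; transitivity ((expR (- t))%:E *
    \esum_(n in [set: nat]) ((t * r) ^+ n / n`!%:R)%:E)%E.
  rewrite -esum_scale ?expR_ge0//; last first.
    by move=> n; rewrite lee_fin divr_ge0// exprn_ge0// mulr_ge0.
  apply: eq_esum => n _; rewrite -EFinM; congr EFin.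
  by rewrite /poisson_weight exprMn; ring.
rewrite esum_exp_coeff ?mulr_ge0// -EFinM -expRD; congr (expR _)%:E; ring.
Qed.

Lemma esum_poisson t : 0 <= t ->
  (\esum_(n in [set: nat]) (poisson_weight t n)%:E = 1)%E.
Proof.
move=> t0; have := esum_poisson_geometric t0 ler01.
rewrite subrr mulr0 oppr0 expR0 => <-; apply: eq_esum => n _.
by rewrite expr1n mulr1.
Qed.

(** The Poisson laws form a convolution semigroup, by the binomial theorem. *)
Lemma poisson_weightD s t k :
  \sum_(n < k.+1) poisson_weight s n * poisson_weight t (k - n)
  = poisson_weight (s + t) k.
Proof.
rewrite /poisson_weight opprD expRD [s + t]addrC exprDn mulr_suml mulr_sumr.
apply: eq_bigr => n _; rewrite -[_ *+ 'C(_, _)]mulr_natr.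
have nk : (n <= k)%N by rewrite -ltnS.
have /(congr1 (fun m => m%:R : R)) := bin_fact nk; rewrite !natrM => e.
have f0 m : m`!%:R != 0 :> R by rewrite pnatr_eq0 -lt0n fact_gt0.
have -> : ('C(k, n)%:R : R) = k`!%:R / (n`!%:R * (k - n)`!%:R).
  by rewrite -e mulfK// mulf_neq0.
by field; rewrite !f0.
Qed.

Definition poisson_mean t g : R :=
  fine (\esum_(n in [set: nat]) (poisson_weight t n * g n)%:E)%E.

Section Mean.
Context {g : nat -> R} (g01 : forall n, 0 <= g n <= 1).

Let g0 n : 0 <= g n. Proof. by have /andP[] := g01 n. Qed.
Let g1 n : g n <= 1. Proof. by have /andP[] := g01 n. Qed.

Lemma poisson_meanE t : 0 <= t ->
  ((poisson_mean t g)%:E =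
   \esum_(n in [set: nat]) (poisson_weight t n * g n)%:E)%E.
Proof.
move=> t0; rewrite /poisson_mean fineK// ge0_fin_numE; last first.
  by apply: esum_ge0 => n _; rewrite lee_fin mulr_ge0// poisson_weight_ge0.
apply: (@le_lt_trans _ _ 1%E); last by rewrite ltry.
rewrite -(esum_poisson t0); apply: le_esum => n _.
by rewrite lee_fin ler_piMr// poisson_weight_ge0.
Qed.

Lemma poisson_mean_ge0 t : 0 <= t -> 0 <= poisson_mean t g.
Proof.
move=> t0; rewrite -lee_fin poisson_meanE//.
by apply: esum_ge0 => n _; rewrite lee_fin mulr_ge0// poisson_weight_ge0.
Qed.

Lemma poisson_mean0 : poisson_mean 0 g = g 0%N.
Proof.
apply: EFin_inj; rewrite poisson_meanE// -(esum_point (t := 0%N) (f := g))//.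
apply: eq_esum => n _; rewrite /poisson_weight oppr0 expR0 mul1r expr0n eq_sym.
by case: n => [|n] //=; rewrite ?fact0 ?divr1// mul0r.
Qed.

Lemma poisson_mean_gt0 t n : 0 < t -> 0 < g n -> 0 < poisson_mean t g.
Proof.
move=> t0 gn; rewrite -lte_fin poisson_meanE ?ltW//.
apply: (@lt_le_trans _ _ (poisson_weight t n * g n)%:E).
  by rewrite lte_fin mulr_gt0// mulr_gt0 ?expR_gt0// divr_gt0 ?exprn_gt0// ltr0n fact_gt0.
apply: esum_ge; exists [set n]; last by rewrite fsbig_set1.
by split => //; exact: finite_set1.
Qed.

Lemma poisson_mean_ge2 t : 0 <= t ->
  poisson_weight t 0 * g 0%N + poisson_weight t 1 * g 1%N <= poisson_mean t g.
Proof.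
move=> t0; rewrite -lee_fin poisson_meanE//.
apply: esum_ge; exists `I_2; first by split.
by rewrite -fsbig_ord !big_ord_recl big_ord0 /= addr0 EFinD.
Qed.

Lemma poisson_mean_semigroup s t : 0 <= s -> 0 <= t ->
  ((poisson_mean (s + t) g)%:E =
   \esum_(n in [set: nat]) \esum_(m in [set: nat])
      (poisson_weight s n * poisson_weight t m * g (n + m)%N)%:E)%E.
Proof.
move=> s0 t0; rewrite poisson_meanE ?addr_ge0// esum_cauchy; last first.
  by move=> n m; rewrite lee_fin mulr_ge0// mulr_ge0 ?poisson_weight_ge0.
apply: eq_esum => k _; rewrite -poisson_weightD mulr_suml sumEFin.
by congr EFin; apply: eq_bigr => n _; rewrite subnKC// -ltnS.
Qed.

End Mean.

Lemma poisson_mean_compl g t : (forall n, 0 <= g n <= 1) -> 0 <= t ->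
  poisson_mean t (fun n => 1 - g n) = 1 - poisson_mean t g.
Proof.
move=> g01 t0; have h01 n : 0 <= 1 - g n <= 1 by have /andP[] := g01 n; lra.
suff : poisson_mean t (fun n => 1 - g n) + poisson_mean t g = 1 by lra.
apply: EFin_inj; rewrite EFinD !poisson_meanE// -esumD; last 2 first.
- move=> n _; rewrite lee_fin mulr_ge0 ?poisson_weight_ge0//.
  by have /andP[] := h01 n.
- move=> n _; rewrite lee_fin mulr_ge0 ?poisson_weight_ge0//.
  by have /andP[] := g01 n.
rewrite -(esum_poisson t0); apply: eq_esum => n _.
by rewrite -EFinD; congr EFin; ring.
Qed.

(** During a short time at most one step is likely: two or more have
    probability of order [t ^+ 2]. *)
Lemma poisson_mean_expansion g t : (forall n, 0 <= g n <= 1) -> 0 <= t ->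
  `|poisson_mean t g - g 0%N - t * (g 1%N - g 0%N)| <= 3 * t ^+ 2.
Proof.
move=> g01 t0.
have h01 n : 0 <= 1 - g n <= 1 by have /andP[] := g01 n; lra.
have := poisson_mean_ge2 h01 t0; have := poisson_mean_ge2 g01 t0.
rewrite poisson_mean_compl// /poisson_weight expr0 expr1 !divr1 mulr1.
have e1 : 1 - t <= expR (- t) by exact: expR_ge1Dx.
have e2 : expR (- t) <= 1 - t + t ^+ 2.
  have := expR_ge1Dx t; rewrite expRN => h.
  have t1 : 0 < 1 + t by lra.
  apply: (@le_trans _ _ (1 + t)^-1); first by rewrite lef_pV2// posrE expR_gt0.
  rewrite -[leLHS]mul1r ler_pdivrMr//.
  have -> : (1 - t + t ^+ 2) * (1 + t) = 1 + t ^+ 3 by ring.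
  by rewrite lerDl exprn_ge0.
have := g01 0%N; have := g01 1%N; move: (poisson_mean t g) => m.
move: (g 0%N) (g 1%N) => a b; move: (expR _) e1 e2 => e e1 e2.
move=> /andP[b0 b1] /andP[a0 a1] l1 l2.
have te1 : t - t ^+ 2 <= t * e by nra.
have te2 : t * e <= t by nra.
rewrite ler_norml; apply/andP; split; nra.
Qed.

Lemma poisson_mean_rate g (L : R) : (forall n, 0 <= g n <= 1) -> 0 <= L ->
  (poisson_mean (L * h) g - g 0%N) / h @[h --> 0^'+] --> L * (g 1%N - g 0%N).
Proof.
move=> g01 L0; apply/cvgrPdist_le => e e0.
have c0 : 0 < 3 * L ^+ 2 + 1 by rewrite ltr_wpDl// mulr_ge0// exprn_ge0.
have K0 : 0 < e / (3 * L ^+ 2 + 1) by rewrite divr_gt0.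
near=> h.
have h0 : 0 < h by near: h; exact: nbhs_right_gt.
have := poisson_mean_expansion g01 (mulr_ge0 L0 (ltW h0)).
move: (poisson_mean _ _) => m H.
have -> : L * (g 1%N - g 0%N) - (m - g 0%N) / h =
   - (m - g 0%N - L * h * (g 1%N - g 0%N)) / h by field; rewrite gt_eqF.
rewrite normrM normrN normfV (gtr0_norm h0) ler_pdivrMr//.
apply: (le_trans H); have -> : 3 * (L * h) ^+ 2 = (3 * L ^+ 2 * h) * h by ring.
apply: ler_wpM2r; first exact: ltW.
apply: (@le_trans _ _ ((3 * L ^+ 2 + 1) * h)); first by rewrite ler_pM2r// lerDl.
rewrite mulrC -ler_pdivlMr//; near: h.
exact: nbhs_right_le.
Unshelve. all: by end_near.
Qed.

(** A geometric rate of convergence along the steps becomes an exponential one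
    in time, by the generating function of the Poisson law. *)
Lemma poisson_mean_cvg g (L l C r : R) : (forall n, 0 <= g n <= 1) -> 0 < L ->
  0 <= r < 1 -> (forall n, `|g n - l| <= C * r ^+ n) ->
  poisson_mean (L * t) g @[t --> +oo] --> l.
Proof.
move=> g01 L0 /andP[r0 r1] gl.
have C0 : 0 <= C by have := gl 0%N; rewrite expr0 mulr1; exact: le_trans.
have l0 : 0 <= l.
  apply: (@geometric_le _ _ _ C r) => [|n]; first by rewrite r0.
  by have := gl n; have /andP[] := g01 n; rewrite ler_distl => ? ? /andP[]; lra.
have bound t : 0 <= t ->
    `|poisson_mean (L * t) g - l| <= C * expR (- (L * t * (1 - r))).
  move=> t0; have Lt0 : 0 <= L * t by rewrite mulr_ge0// ltW.
  have gn0 n : 0 <= g n by have /andP[] := g01 n.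
  have w0 n := poisson_weight_ge0 n Lt0.
  have sumC : (\esum_(n in [set: nat])
      (poisson_weight (L * t) n * (C * r ^+ n))%:E
      = (C * expR (- (L * t * (1 - r))))%:E)%E.
    rewrite EFinM -esum_poisson_geometric// -esum_scale//; last first.
      by move=> n; rewrite lee_fin mulr_ge0// exprn_ge0.
    by apply: eq_esum => n _; rewrite -EFinM; congr EFin; ring.
  have suml : (\esum_(n in [set: nat])
      (poisson_weight (L * t) n * l)%:E = l%:E)%E.
    rewrite -[RHS]mule1 -(esum_poisson Lt0) -esum_scale//.
    by apply: eq_esum => n _; rewrite -EFinM mulrC.
  rewrite ler_distl; apply/andP; split.
    rewrite lerBlDr -lee_fin EFinD poisson_meanE// -sumC -esumD; last 2 first.
    - by move=> n _; rewrite lee_fin mulr_ge0.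
    - by move=> n _; rewrite lee_fin !mulr_ge0// exprn_ge0.
    rewrite -{1}suml; apply: le_esum => n _.
    rewrite -EFinD lee_fin -mulrDr ler_wpM2l//.
    by have := gl n; rewrite ler_distl => /andP[]; lra.
  rewrite -lee_fin EFinD poisson_meanE// -sumC -{1}suml -esumD; last 2 first.
  - by move=> n _; rewrite lee_fin mulr_ge0.
  - by move=> n _; rewrite lee_fin !mulr_ge0// exprn_ge0.
  apply: le_esum => n _.
  rewrite -EFinD lee_fin -mulrDr ler_wpM2l//.
  by have := gl n; rewrite ler_distl => /andP[]; lra.
have K0 : 0 < L * (1 - r) by rewrite mulr_gt0// subr_gt0.
apply/cvgrPdist_le => e e0; near=> t.
have t0 : 0 < t by near: t; apply: nbhs_pinfty_gt; exact: num_real.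
rewrite distrC; apply: (le_trans (bound t (ltW t0))).
rewrite expRN -ler_pdivlMr ?invr_gt0 ?expR_gt0// invrK.
apply: (@le_trans _ _ (e * (1 + L * t * (1 - r)))); last first.
  by rewrite ler_pM2l// expR_ge1Dx.
rewrite mulrC -ler_pdivrMr// -lerBlDl.
have -> : L * t * (1 - r) = t * (L * (1 - r)) by ring.
rewrite -ler_pdivrMr//; near: t; apply: nbhs_pinfty_ge; exact: num_real.
Unshelve. all: by end_near.
Qed.

End Poisson.

(** * Markov chains with finitely many moves *)

Section Moves.
Context {R : realType} {S : countType} {I : finType}.
Variables (move : I -> S -> S) (weight : I -> S -> R).
Hypothesis weight_ge0 : forall i x, 0 <= weight i x.
Hypothesis weight_sum1 : forall x, \sum_i weight i x = 1.
Implicit Types (f g : S -> R).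

Definition step f : S -> R := fun x => \sum_i weight i x * f (move i x).

Definition ptrans (n : nat) (x y : S) : R :=
  iter n step (fun z => (z == y)%:R) x.

Lemma iter_step_le f g n x :
  (forall y, f y <= g y) -> iter n step f x <= iter n step g x.
Proof.
move=> fg; elim: n x => [|n IH] x //=.
by apply: ler_sum => i _; rewrite ler_wpM2l.
Qed.

Lemma iter_stepD f g n x :
  iter n step (fun y => f y + g y) x = iter n step f x + iter n step g x.
Proof.
elim: n x => [|n IH] x //=; rewrite /step -big_split; apply: eq_bigr => i _.
by rewrite IH mulrDr.
Qed.

Lemma iter_stepZ c f n x :
  iter n step (fun y => c * f y) x = c * iter n step f x.
Proof.
elim: n x => [|n IH] x //=; rewrite /step mulr_sumr; apply: eq_bigr => i _.
by rewrite IH mulrCA.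
Qed.

Lemma iter_step_cst (c : R) n x : iter n step (fun=> c) x = c.
Proof.
elim: n x => [|n IH] x //=; rewrite /step.
under eq_bigr do rewrite IH.
by rewrite -mulr_suml weight_sum1 mul1r.
Qed.

Lemma iter_step_01 f n x :
  (forall y, 0 <= f y <= 1) -> 0 <= iter n step f x <= 1.
Proof.
move=> f01; rewrite -{1}(iter_step_cst 0 n x) -(iter_step_cst 1 n x).
by apply/andP; split; apply: iter_step_le => y; have /andP[] := f01 y.
Qed.

Lemma iter_step_ge0 f n x : (forall y, 0 <= f y) -> 0 <= iter n step f x.
Proof. by move=> f0; rewrite -(iter_step_cst 0 n x); apply: iter_step_le. Qed.

Lemma ptrans_01 n x y : 0 <= ptrans n x y <= 1.
Proof. by apply: iter_step_01 => z; case: eqP => _ /=; rewrite ?lexx ?ler01. Qed.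

Lemma ptrans_ge0 n x y : 0 <= ptrans n x y.
Proof. by have /andP[] := ptrans_01 n x y. Qed.

Lemma esum_ptrans f n x : (forall y, 0 <= f y) ->
  (\esum_(y in [set: S]) (ptrans n x y * f y)%:E = (iter n step f x)%:E)%E.
Proof.
move=> f0; elim: n x => [|n IH] x.
  by rewrite -[RHS](esum_point (t := x) (f := f)).
rewrite /= /step -sumEFin.
transitivity (\esum_(y in [set: S])
    \sum_i (weight i x)%:E * (ptrans n (move i x) y * f y)%:E)%E.
  apply: eq_esum => y _; rewrite /ptrans /= /step mulr_suml -sumEFin.
  by apply: eq_bigr => i _; rewrite -EFinM mulrA.
rewrite esum_sum; last by move=> y i _ _; rewrite -EFinM lee_fin !mulr_ge0// ptrans_ge0.
apply: eq_bigr => i _; rewrite esum_scale// ?IH//.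
by move=> y; rewrite lee_fin mulr_ge0// ptrans_ge0.
Qed.

Lemma esum_ptrans1 n x : (\esum_(y in [set: S]) (ptrans n x y)%:E = 1)%E.
Proof.
rewrite -[RHS]/(1%:E) -(iter_step_cst 1 n x) -esum_ptrans//.
by apply: eq_esum => y _; rewrite mulr1.
Qed.

Lemma chapman_kolmogorov n m x z :
  (\esum_(y in [set: S]) (ptrans n x y * ptrans m y z)%:E
   = (ptrans (n + m) x z)%:E)%E.
Proof.
by rewrite (esum_ptrans (f := fun y => ptrans m y z)) /ptrans ?iterD// => y; exact: ptrans_ge0.
Qed.

Lemma ptrans_mul_le n m x y z :
  ptrans n x y * ptrans m y z <= ptrans (n + m) x z.
Proof.
rewrite -lee_fin -chapman_kolmogorov; apply: esum_ge.
by exists [set y]; rewrite ?fsbig_set1//; split => //; exact: finite_set1.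
Qed.

Lemma ptrans_move i x : 0 < weight i x -> 0 < ptrans 1 x (move i x).
Proof.
move=> wi; rewrite /ptrans /= /step (bigD1 i)//= eqxx mulr1 ltr_pwDl//.
by apply: sumr_ge0 => j _; rewrite mulr_ge0.
Qed.

Definition reaches x y := exists n, 0 < ptrans n x y.

Lemma reaches_refl x : reaches x x.
Proof. by exists 0%N; rewrite /ptrans /= eqxx. Qed.

Lemma reaches_trans x y z : reaches x y -> reaches y z -> reaches x z.
Proof.
move=> [n xy] [m yz]; exists (n + m)%N.
by apply: (lt_le_trans _ (ptrans_mul_le n m x y z)); rewrite mulr_gt0.
Qed.

Lemma reaches_move i x : 0 < weight i x -> reaches x (move i x).
Proof. by exists 1%N; exact: ptrans_move. Qed.

(** * Geometric ergodicity by Harris' argument *)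

Section Harris.
Variables (V : S -> R) (gam b : R) (z0 : S).
Hypothesis V_ge0 : forall x, 0 <= V x.
Hypothesis gam01 : 0 <= gam < 1.
Hypothesis b_gt0 : 0 < b.
Hypothesis drift : forall x, step V x <= gam * V x + b.
Hypothesis finite_sublevel : forall r, finite_set [set x | V x <= r].
Hypothesis irred : forall x y, reaches x y.
Hypothesis lazy : forall x, 0 < ptrans 1 x x.

Let K := b / (1 - gam).

Let gam0 : 0 <= gam. Proof. by have /andP[] := gam01. Qed.
Let gam1 : 0 < 1 - gam. Proof. by have /andP[_] := gam01; rewrite subr_gt0. Qed.
Let K_gt0 : 0 < K. Proof. by rewrite divr_gt0. Qed.

Lemma iter_drift n x : iter n step V x <= gam ^+ n * V x + K.
Proof.
elim: n x => [|n IH] x; first by rewrite expr0 mul1r lerDl ltW.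
rewrite iterSr.
have : iter n step (step V) x <= iter n step (fun y => gam * V y + b) x.
  exact: iter_step_le.
rewrite iter_stepD iter_stepZ iter_step_cst => /le_trans; apply.
have : gam * iter n step V x <= gam * (gam ^+ n * V x + K) by rewrite ler_wpM2l.
have KE : gam * K + b = K by rewrite /K; field; rewrite gt_eqF.
by rewrite mulrDr mulrA -exprS; lra.
Qed.

Lemma ptrans_lazy_gt0 n m x y : (n <= m)%N -> 0 < ptrans n x y -> 0 < ptrans m x y.
Proof.
move=> /subnK <-; elim: (m - n)%N => [//|k IH] /IH h.
rewrite addSn -addn1 addnC; apply: lt_le_trans (ptrans_mul_le _ _ _ x _).
by rewrite mulr_gt0.
Qed.

(** Sublevel sets are small in the sense of Harris' theorem: they are finite and
    the chain is lazy, so that one common number of steps leads from all of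
    their states to [z0]. *)
Lemma small_sublevel r :
  exists2 n, (0 < n)%N &
  exists2 al : R, 0 < al <= 1 & forall x, V x <= r -> al <= ptrans n x z0.
Proof.
have /finite_seqP[s sE] := finite_sublevel r.
have [n n0 nP] : exists2 n, (0 < n)%N & forall x, x \in s -> 0 < ptrans n x z0.
  elim: s {sE} => [|x s [n n0 IH]]; first by exists 1%N.
  have [m xm] := irred x z0; exists (maxn n m); first by rewrite leq_max n0.
  move=> y; rewrite inE => /orP[/eqP -> |ys].
    exact: ptrans_lazy_gt0 (leq_maxr n m) xm.
  exact: ptrans_lazy_gt0 (leq_maxl n m) (IH _ ys).
exists n => //; exists (\prod_(x <- s) ptrans n x z0).
  apply/andP; split; last by apply: prodr_ile1 => x _; exact: ptrans_01.
  by rewrite big_seq; apply: prodr_gt0.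
move=> x Vx; have xs : x \in s by have : [set` s] x by rewrite -sE.
rewrite (big_rem x)//= ler_piMr ?ptrans_ge0//.
by apply: prodr_ile1 => y _; exact: ptrans_01.
Qed.

(** Two independent copies of the chain meet at [z0] with probability at least
    [al ^+ 2] when they start in a common sublevel set; elsewhere the drift
    alone contracts the weight [2 + be * V x + be * V y]. The weight [be] is so
    small that the additive term of the drift costs half of what the meeting
    gains, and the level [8 * K / (1 - gam)] so high that above it the
    contraction of [be * (V x + V y)] outweighs this term. *)
Lemma harris_contraction : exists n (be rho : R),
  [/\ (0 < n)%N, 0 <= be, 0 < rho < 1 & forall f (c : R), 0 <= c ->
    (forall x y, f x - f y <= c * (2 + be * V x + be * V y)) ->
    forall x y, iter n step f x - iter n step f y
      <= rho * c * (2 + be * V x + be * V y)].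
Proof.
have [n n0 [al /andP[al0 al1] alP]] := small_sublevel (8 * K / (1 - gam)).
pose be := al ^+ 2 / (2 * K).
have be0 : 0 < be by rewrite divr_gt0 ?exprn_gt0// mulr_gt0.
have beK : be * K = al ^+ 2 / 2 by rewrite /be; field; rewrite gt_eqF.
pose rho := Num.max (1 - al ^+ 2 / 2) ((1 + gam) / 2).
have gam_ge0 := gam0; have gam_lt1 : gam < 1 by have /andP[] := gam01.
have rho1 : 1 - al ^+ 2 / 2 <= rho by rewrite le_max lexx.
have rho2 : (1 + gam) / 2 <= rho by rewrite le_max lexx orbT.
have al2 : 0 < al ^+ 2 by rewrite exprn_gt0.
exists n, be, rho; split => //; first exact: ltW.
  apply/andP; split; first by apply: lt_le_trans rho2; lra.
  by rewrite gt_max; apply/andP; split; lra.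
move=> f c c0 fP x y.
have driftn z : iter n step V z <= gam * V z + K.
  apply: (le_trans (iter_drift n z)); rewrite lerD2r ler_wpM2r//.
  by rewrite -(prednK n0) exprS ler_piMr// exprn_ile1// ltW.
(* the bound improves by [2 * c] when both copies sit at [z0] *)
have meet u v :
    f u <= f v + c * (2 + be * V u + be * V v)
             - 2 * c * ((u == z0)%:R * (v == z0)%:R).
  have := fP u v.
  have : 0 <= c * (be * V u) by rewrite mulr_ge0// mulr_ge0// ltW.
  have : 0 <= c * (be * V v) by rewrite mulr_ge0// mulr_ge0// ltW.
  case: eqP => [->|_]; case: eqP => [->|_]; rewrite ?mul1r ?mul0r ?mulr0 ?mulr1; nra.
have avg1 v : iter n step f x <=
    f v + c * (2 + be * iter n step V x + be * V v)
      - 2 * c * (ptrans n x z0 * (v == z0)%:R).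
  have : iter n step f x <= iter n step (fun u => (c * be) * V u + (
      (- (2 * c * (v == z0)%:R)) * (u == z0)%:R
      + (f v + c * (2 + be * V v)))) x.
    by apply: iter_step_le => u; apply: (le_trans (meet u v)); rewrite le_eqVlt;
      apply/orP; left; apply/eqP; ring.
  rewrite !iter_stepD !iter_stepZ !iter_step_cst -/(ptrans n x z0).
  by move/le_trans; apply; rewrite le_eqVlt; apply/orP; left; apply/eqP; ring.
have avg2 : iter n step f x <=
    iter n step f y + c * (2 + be * iter n step V x + be * iter n step V y)
      - 2 * c * (ptrans n x z0 * ptrans n y z0).
  rewrite -(iter_step_cst (iter n step f x) n y).
  have : iter n step (fun=> iter n step f x) y <=
    iter n step (fun v => f v + ((c * be) * V v + (
      (- (2 * c * ptrans n x z0)) * (v == z0)%:R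
      + (c * (2 + be * iter n step V x))))) y.
    by apply: iter_step_le => v; apply: (le_trans (avg1 v)); rewrite le_eqVlt;
      apply/orP; left; apply/eqP; ring.
  rewrite !iter_stepD !iter_stepZ !iter_step_cst -/(ptrans n y z0).
  by move/le_trans; apply; rewrite le_eqVlt; apply/orP; left; apply/eqP; ring.
have px := ptrans_ge0 n x z0; have py := ptrans_ge0 n y z0.
rewrite lerBlDl; apply: (le_trans avg2); rewrite -addrA lerD2l.
have -> : c * (2 + be * iter n step V x + be * iter n step V y)
    - 2 * c * (ptrans n x z0 * ptrans n y z0) =
  c * ((2 + be * iter n step V x + be * iter n step V y)
    - 2 * (ptrans n x z0 * ptrans n y z0)) by ring.
rewrite -(mulrA rho c) (mulrCA rho c); apply: ler_wpM2l => //.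
set s := V x + V y.
have s0 : 0 <= s by rewrite addr_ge0.
have -> : 2 + be * V x + be * V y = 2 + be * s by rewrite /s; ring.
have h1 : be * iter n step V x + be * iter n step V y <= be * gam * s + al ^+ 2.
  have : be * iter n step V x <= be * (gam * V x + K) by rewrite ler_wpM2l// ltW.
  have : be * iter n step V y <= be * (gam * V y + K) by rewrite ler_wpM2l// ltW.
  by rewrite !mulrDr beK /s; lra.
have bs0 : 0 <= be * s by rewrite mulr_ge0// ltW.
have [sle|slt] := lerP s (8 * K / (1 - gam)).
  have ax : al <= ptrans n x z0.
    by apply: alP; apply: le_trans sle; rewrite /s lerDl.
  have ay : al <= ptrans n y z0.
    by apply: alP; apply: le_trans sle; rewrite /s lerDr.
  have pp : al ^+ 2 <= ptrans n x z0 * ptrans n y z0.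
    by rewrite expr2 ler_pM// ltW.
  have : gam * (be * s) <= rho * (be * s) by rewrite ler_wpM2r//; lra.
  by nra.
have pp : 0 <= ptrans n x z0 * ptrans n y z0 by rewrite mulr_ge0.
have sbig : 4 * al ^+ 2 <= be * s * (1 - gam).
  move: slt; rewrite ltr_pdivrMr// => h.
  have : be * (8 * K) <= be * (s * (1 - gam)) by rewrite ler_pM2l// ltW.
  by rewrite mulrCA beK; lra.
have : (1 + gam) / 2 * (be * s) <= rho * (be * s) by rewrite ler_wpM2r.
by nra.
Qed.

(** The contraction acts once every [k] steps; spreading it evenly over the
    steps gives a rate valid at all times. *)
Lemma geometric_mixing : exists (be C r : R),
  [/\ 0 <= be, 0 <= C, 0 <= r < 1 & forall f, (forall x, 0 <= f x <= 1) ->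
    forall n x y, iter n step f x - iter n step f y
      <= C * r ^+ n * (2 + be * V x + be * V y)].
Proof.
have [k [be [rho [k0 be0 /andP[rho0 rho1] H]]]] := harris_contraction.
pose r := 1 - (1 - rho) / k%:R.
have kR : 0 < k%:R :> R by rewrite ltr0n.
have k1 : 1 <= k%:R :> R by rewrite ler1n.
have r1 : r < 1 by rewrite /r ltrBlDr ltrDl divr_gt0// subr_gt0.
have rho_r : rho <= r.
  rewrite /r lerBrDr -lerBrDl ler_pdivrMr// ler_peMr// subr_ge0; exact: ltW.
have r0 : 0 <= r by exact: le_trans (ltW rho0) rho_r.
(* by Bernoulli's inequality, [k] factors [r] weaken one contraction factor *)
have rk : rho <= r ^+ k.
  have bern m : 1 - m%:R * (1 - r) <= r ^+ m.
    elim: m => [|m IH]; first by rewrite mul0r subr0 expr0.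
    have : r * (1 - m%:R * (1 - r)) <= r * r ^+ m by rewrite ler_wpM2l.
    rewrite -exprS => /(le_trans _); apply.
    have : 0 <= m%:R * (1 - r) ^+ 2 by rewrite mulr_ge0// exprn_ge0// subr_ge0 ltW.
    by rewrite -natr1; nra.
  apply: le_trans (bern k).
  by rewrite /r opprB addrCA subrr addr0 mulrCA divff ?mulr1 ?gt_eqF//; lra.
have rgt0 : 0 < r by exact: lt_le_trans rho_r.
exists be, (r ^- k), r; split => //.
- by rewrite invr_ge0 exprn_ge0.
- by rewrite r0.
move=> f f01 n x y.
have iterated q : forall x y, iter (q * k)%N step (iter (n %% k)%N step f) x
    - iter (q * k)%N step (iter (n %% k)%N step f) y
    <= rho ^+ q * (2 + be * V x + be * V y).
  elim: q => [|q IH] x' y'.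
    rewrite mul0n expr0 mul1r /=.
    have /andP[_ h1] := iter_step_01 (n %% k)%N x' f01.
    have /andP[h2 _] := iter_step_01 (n %% k)%N y' f01.
    have := mulr_ge0 be0 (V_ge0 x'); have := mulr_ge0 be0 (V_ge0 y').
    by lra.
  rewrite mulSn !iterD exprS; apply: (H _ (rho ^+ q)); last exact: IH.
  by rewrite exprn_ge0// ltW.
have := iterated (n %/ k)%N x y; rewrite -!iterD -divn_eq => /le_trans; apply.
have W0 : 0 <= 2 + be * V x + be * V y by rewrite !addr_ge0// mulr_ge0.
apply: ler_wpM2r => //.
have : rho ^+ (n %/ k) <= r ^+ (k * (n %/ k)).
  rewrite exprM; apply: lerXn2r => //; rewrite nnegrE ?exprn_ge0//.
  exact: ltW.
move/le_trans; apply; rewrite mulrC ler_pdivlMr ?exprn_gt0//.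
rewrite [X in _ <= r ^+ X](divn_eq n k) exprD [(_ * k)%N]mulnC ler_wpM2l ?exprn_ge0//.
by apply: ler_wiXn2l => //; [exact: ltW|rewrite ltnW// ltn_pmod].
Qed.

(** Averaging the mixing bound over the state reached after [m] further steps
    compares the chain at times [n] and [n + m], so the means form a Cauchy
    sequence whose limit does not depend on the initial state. *)
Lemma geometric_convergence : exists (c : S -> R) (r : R),
  [/\ forall x, 0 <= c x, 0 <= r < 1 & forall f, (forall x, 0 <= f x <= 1) ->
    exists l, forall n x, `|iter n step f x - l| <= c x * r ^+ n].
Proof.
have [be [C [r [be0 C0 r01 H]]]] := geometric_mixing.
have r0 : 0 <= r by have /andP[] := r01.
pose c x := C * (2 + be * (V x + K) + be * V z0).
have K0 := K_gt0.
have c0 x : 0 <= c x.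
  by rewrite mulr_ge0// !addr_ge0// mulr_ge0// ?addr_ge0// ltW.
exists c, r; split => // f f01.
have Vn m x : iter m step V x <= V x + K.
  apply: (le_trans (iter_drift m x)); rewrite lerD2r ler_piMl//.
  by rewrite exprn_ile1//; have /andP[_ /ltW] := gam01.
have mixed g n m x y : (forall z, 0 <= g z <= 1) ->
    iter m step (iter n step g) x - iter n step g y
      <= C * r ^+ n * (2 + be * (V x + K) + be * V y).
  move=> g01; rewrite lerBlDr.
  have : iter m step (iter n step g) x <= iter m step (fun z =>
      (C * r ^+ n * be) * V z + (C * r ^+ n * (2 + be * V y)
       + iter n step g y)) x.
    apply: iter_step_le => z; rewrite -lerBlDr.
    by have := H g g01 n z y; lra.
  rewrite iter_stepD iter_stepZ iter_step_cst => /le_trans; apply.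
  have Crb : 0 <= C * r ^+ n * be by rewrite !mulr_ge0// exprn_ge0.
  by have := ler_wpM2l Crb (Vn m x); lra.
have cauchy n m x y : (n <= m)%N ->
  `|iter m step f x - iter n step f y|
    <= C * r ^+ n * (2 + be * (V x + K) + be * V y).
  move=> /subnK <-; rewrite iterD ler_norml lerNl opprB; apply/andP; split; last exact: mixed.
  have := mixed (fun z => 1 - f z) n (m - n)%N x y.
  have compl k z (g : S -> R) : iter k step (fun z => 1 - g z) z = 1 - iter k step g z.
    rewrite -{2}(iter_step_cst 1 k z) -mulN1r -iter_stepZ -iter_stepD.
    by congr (iter k step _ z); apply/funext => u; rewrite mulN1r.
  have -> : iter n step (fun z => 1 - f z) = (fun z => 1 - iter n step f z).
    by apply/funext => z; rewrite compl.
  rewrite compl opprB addrA -addrA; move=> h; apply: le_trans (h _); last first.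
    by move=> z; have := f01 z; lra.
  by rewrite le_eqVlt; apply/orP; left; apply/eqP; ring.
pose A := [set iter n step f z0 - c z0 * r ^+ n | n in [set: nat]].

have Crn n : 0 <= C * r ^+ n by rewrite mulr_ge0// exprn_ge0.
have ub n x : ubound A (iter n step f x + c x * r ^+ n).
  move=> _ [m _ <-].
  have near_x : iter n step f z0 <= iter n step f x + c x * r ^+ n.
    have := H f f01 n z0 x.
    have : 0 <= C * r ^+ n * (be * K) by rewrite mulr_ge0// mulr_ge0// ltW.
    by rewrite /c; lra.
  have [mn|/ltnW nm] := leqP m n.
    have := cauchy m n z0 z0 mn; rewrite mulrAC -/(c z0) ler_distl => /andP[].
    by move: near_x; lra.
  have := cauchy n m z0 x nm; rewrite ler_distl => /andP[_].
  have : 0 <= c z0 * r ^+ m by rewrite mulr_ge0// exprn_ge0.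
  by rewrite /c; lra.
(* the limit is the supremum of the lower ends of the error intervals *)
have A0 : A !=set0 by exists (iter 0 step f z0 - c z0 * r ^+ 0), 0%N.
have hsA : has_sup A by split => //; exists (iter 0 step f z0 + c z0 * r ^+ 0); exact: ub.
exists (sup A) => n x; rewrite ler_distlC; apply/andP; split; last by apply: ge_sup.
apply: (@geometric_le _ _ _ (c z0 * r ^+ n) r) => // m.
have mem : A (iter (m + n) step f z0 - c z0 * r ^+ (m + n)) by exists (m + n)%N.
have /ubP/(_ _ mem) := sup_upper_bound hsA.
have := cauchy n (m + n)%N z0 x (leq_addl _ _); rewrite ler_distl => /andP[+ _].
by rewrite exprD /c; lra.
Qed.

(** By tightness -- the drift bounds the mean of [V] uniformly in time -- no
    mass escapes to infinity, so pointwise limits of transition probabilities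
    integrate bounded functions to the limits of their means. *)
Lemma invariant_distribution : exists (pi : S -> R) (c : S -> R) (r : R),
  [/\ 0 <= r < 1, forall n x y, `|ptrans n x y - pi y| <= c x * r ^+ n,
   distribution_on pi & forall n y,
     (\esum_(x in [set: S]) (pi x * ptrans n x y)%:E = (pi y)%:E)%E].
Proof.
have [c [r [c0 r01 H]]] := geometric_convergence.
have r0 : 0 <= r by have /andP[] := r01.
have dirac01 (y z : S) : 0 <= ((z == y)%:R : R) <= 1.
  by case: eqP => _ /=; rewrite ?lexx ?ler01.
have /choice[pi piP] : forall y, exists l, forall n x,
    `|ptrans n x y - l| <= c x * r ^+ n by move=> y; apply: H; exact: dirac01.
have pi0 y : 0 <= pi y.
  apply: (@geometric_le _ _ _ (c z0) r) => // n.
  have := piP y n z0; have := ptrans_ge0 n z0 y.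
  by rewrite ler_distl /ptrans => ? /andP[]; lra.
have mass f l : (forall x, 0 <= f x <= 1) ->
    (forall n x, `|iter n step f x - l| <= c x * r ^+ n) ->
    (\esum_(y in [set: S]) (pi y * f y)%:E = l%:E)%E.
  move=> f01 fl.
  have f0 y : 0 <= f y by have /andP[] := f01 y.
  have f1 y : f y <= 1 by have /andP[] := f01 y.
  (* over a finite set the pointwise convergence is uniform *)
  have finite (X : seq S) n :
      `|\sum_(y <- X) ptrans n z0 y * f y - \sum_(y <- X) pi y * f y|
        <= (size X)%:R * c z0 * r ^+ n.
    elim: X => [|y X IH]; first by rewrite !big_nil subr0 normr0 mul0r mul0r.
    rewrite !big_cons /= -natr1 opprD addrACA.
    have := ler_normD (ptrans n z0 y * f y - pi y * f y)
      (\sum_(y <- X) ptrans n z0 y * f y - \sum_(y <- X) pi y * f y).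
    move/le_trans; apply; rewrite -mulrBl normrM (ger0_norm (f0 y)).
    have : `|ptrans n z0 y - pi y| * f y <= c z0 * r ^+ n.
      by apply: le_trans (piP y n z0); rewrite ler_piMr.
    by move: IH; lra.
  have l0 : 0 <= l.
    apply: (@geometric_le _ _ _ (c z0) r) => // n.
    have := fl n z0; have /andP[] := iter_step_01 n z0 f01.
    by rewrite ler_distl => ? ? /andP[]; lra.
  have upper : (\esum_(y in [set: S]) (pi y * f y)%:E <= l%:E)%E.
    apply: ge_ereal_sup => _ [X [finX _] <-].
    rewrite fsbig_finite//= sumEFin lee_fin.
    apply: (@geometric_le _ _ _
        ((size (finmap.enum_fset (fset_set X)))%:R * c z0 + c z0) r) => // n.
    have : \sum_(y <- finmap.enum_fset (fset_set X)) ptrans n z0 y * f y <= iter n step f z0.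
      rewrite -lee_fin -esum_ptrans// -sumEFin -fsbig_finite//.
      by apply: esum_ge; exists X.
    have := finite (finmap.enum_fset (fset_set X)) n; have := fl n z0.
    by rewrite !ler_distl => /andP[? ?] /andP[? ?]; lra.
  have lower lev : 0 < lev -> (l%:E <= \esum_(y in [set: S]) (pi y * f y)%:E
      + ((V z0 + K) / lev)%:E)%E.
    move=> lev0; have finX := finite_sublevel lev.
    set X := [set x | V x <= lev] in finX.
    have cut n : iter n step f z0 <=
        \sum_(y <- finmap.enum_fset (fset_set X)) ptrans n z0 y * f y + (V z0 + K) / lev.
      have tail : iter n step V z0 / lev <= (V z0 + K) / lev.
        rewrite ler_pM2r ?invr_gt0//; apply: (le_trans (iter_drift n z0)).
        by rewrite lerD2r ler_piMl// exprn_ile1//; have /andP[_ /ltW] := gam01.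
      apply: le_trans (lerD (lexx _) tail).
      have -> : \sum_(y <- finmap.enum_fset (fset_set X)) ptrans n z0 y * f y
          = iter n step (fun y => (y \in X)%:R * f y) z0.
        apply: EFin_inj; rewrite -esum_ptrans; last by move=> y; rewrite mulr_ge0.
        rewrite -sumEFin -fsbig_finite// -esum_fset//; last first.
          by move=> y _; rewrite lee_fin mulr_ge0// ptrans_ge0.
        rewrite esum_mkcond; apply: eq_esum => y _.
        by case: ifPn => _; rewrite ?mul1r// mul0r mulr0.
      rewrite mulrC -iter_stepZ -iter_stepD; apply: iter_step_le => y.
      case: (boolP (y \in X)) => [_|].
        by rewrite mul1r lerDl mulr_ge0// invr_ge0 ltW.
      rewrite notin_setE => /= /negP; rewrite -ltNge => yX.
      rewrite mul0r add0r; apply: le_trans (f1 y) _.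
      by rewrite mulrC ler_pdivlMr// mul1r ltW.
    apply: (@le_trans _ _
        (\sum_(y <- finmap.enum_fset (fset_set X)) pi y * f y + (V z0 + K) / lev)%:E).
      rewrite lee_fin.
      apply: (@geometric_le _ _ _
        ((size (finmap.enum_fset (fset_set X)))%:R * c z0 + c z0) r) => // n.
      have := cut n; have := finite (finmap.enum_fset (fset_set X)) n; have := fl n z0.
      by rewrite !ler_distl => /andP[? ?] /andP[? ?]; lra.
    rewrite EFinD leeD2r// -sumEFin -fsbig_finite//.
    by apply: esum_ge; exists X.
  apply/eqP; rewrite eq_le upper /=.
  move: upper lower; case: (\esum_(y in _) _)%E => [E| |]// _ lower; last first.
    by have := lower 1 ltr01.
  rewrite lee_fin leNgt; apply/negP => El.
  have M0 : 0 < V z0 + K + 1 by rewrite ltr_wpDl// addr_ge0// ltW// K_gt0.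
  have lE0 : 0 < l - E by rewrite subr_gt0.
  have := lower ((V z0 + K + 1) / (l - E)) (divr_gt0 M0 lE0).
  rewrite -EFinD lee_fin invf_div mulrA leNgt => /negP; apply.
  rewrite -ltrBrDl ltr_pdivrMr// mulrC ltr_pM2l//; lra.
exists pi, c, r; split => //.
- split; first exact: pi0.
  rewrite -[RHS]/(1%:E) -(@mass (fun=> 1) 1).
  + by apply: eq_esum => y _; rewrite mulr1.
  + by move=> _; rewrite ler01 lexx.
  + by move=> n x; rewrite iter_step_cst subrr normr0 mulr_ge0// exprn_ge0.
- move=> m y; apply: mass => [x|n x]; first exact: ptrans_01.
  have -> : iter n step (ptrans m ^~ y) x = ptrans (n + m) x y.
    by rewrite /ptrans iterD.
  apply: (le_trans (piP y (n + m)%N x)); rewrite exprD mulrA ler_piMr//.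
    by rewrite mulr_ge0// exprn_ge0.
  by rewrite exprn_ile1//; have /andP[_ /ltW] := r01.
Qed.
(** By Tonelli's theorem, the semigroup law and the stationarity of the
    continuous-time chain reduce to those of the powers of the kernel. *)
Lemma esum_poisson_mean (G : S -> nat -> R) h t : 0 <= t ->
  (forall y n, 0 <= G y n <= 1) -> (forall y, 0 <= h y) ->
  (\esum_(y in [set: S]) (poisson_mean t (G y) * h y)%:E =
   \esum_(n in [set: nat]) ((poisson_weight t n)%:E *
     \esum_(y in [set: S]) (G y n * h y)%:E))%E.
Proof.
move=> t0 G01 h0; have G0 y n : 0 <= G y n by have /andP[] := G01 y n.
transitivity (\esum_(y in [set: S]) \esum_(n in [set: nat])
    ((poisson_weight t n)%:E * (G y n * h y)%:E))%E.
  apply: eq_esum => y _; rewrite EFinM (poisson_meanE (G01 y))// muleC.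
  rewrite -esum_scale//; last first.
    by move=> n; rewrite lee_fin mulr_ge0// poisson_weight_ge0.
  by apply: eq_esum => n _; rewrite -!EFinM; congr EFin; ring.
rewrite esum_exchange; last first.
  by move=> y n; rewrite -EFinM lee_fin mulr_ge0 ?poisson_weight_ge0// mulr_ge0.
apply: eq_esum => n _; rewrite esum_scale ?poisson_weight_ge0// => y.
by rewrite lee_fin mulr_ge0.
Qed.

Section Uniformization.
Variables (q : S -> S -> R) (L : R).
Hypothesis L_gt0 : 0 < L.
Hypothesis qE : forall x y, x != y -> q x y = L * ptrans 1 x y.

(** The chain run at the jump times of a Poisson process of rate [L]. *)
Definition uniformized (t : R) (x y : S) : R :=
  poisson_mean (L * t) (fun n => ptrans n x y).

Let L0 : 0 <= L. Proof. exact: ltW. Qed.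

Lemma uniformized_exit_rate x : exit_rate q x = L * (1 - ptrans 1 x x).
Proof.
rewrite /exit_rate.
have := esum_ptrans1 1 x; rewrite (esumID [set x]); last first.
  by move=> y _; rewrite lee_fin ptrans_ge0.
rewrite !setTI esum_set1 ?lee_fin ?ptrans_ge0// => tot.
have -> : (\esum_(y in [set y | y != x]) (q x y)%:E =
    \esum_(y in ~` [set x]) (L%:E * (ptrans 1 x y)%:E))%E.
  rewrite (_ : [set y | y != x] = ~` [set x]); last first.
    by apply/seteqP; split => y /= /eqP.
  by apply: eq_esum => y /= /eqP yx; rewrite qE ?EFinM// eq_sym.
have -> : (\esum_(y in ~` [set x]) (L%:E * (ptrans 1 x y)%:E) =
    L%:E * \esum_(y in ~` [set x]) (ptrans 1 x y)%:E)%E.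
  rewrite esum_mkcond [in RHS]esum_mkcond -esum_scale//.
    by apply: eq_esum => y _; case: ifP => // _; rewrite mule0.
  by move=> y; case: ifP => // _; rewrite lee_fin ptrans_ge0.
move: tot; case: (\esum_(y in _) _)%E => // e.
rewrite -EFinD => -[] <-; rewrite -EFinM /=; congr (_ * _); ring.
Qed.

Lemma uniformized_transition : transition_function q uniformized.
Proof.
have p01 x y n := ptrans_01 n x y.
split.
- by move=> t x y t0; apply: poisson_mean_ge0; rewrite ?mulr_ge0.
- move=> t x t0.
  under eq_esum do rewrite -(mulr1 (uniformized _ _ _)).
  rewrite (esum_poisson_mean (G := fun y n => ptrans n x y)) ?mulr_ge0//.
  rewrite -(esum_poisson (t := L * t)) ?mulr_ge0//; apply: eq_esum => n _.
  under eq_esum do rewrite mulr1.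
  by rewrite esum_ptrans1 mule1.
- by move=> x y; rewrite /uniformized mulr0 poisson_mean0.
- move=> s t x z s0 t0.
  have Ls : 0 <= L * s by rewrite mulr_ge0.
  have Lt : 0 <= L * t by rewrite mulr_ge0.
  rewrite /uniformized mulrDr poisson_mean_semigroup// esum_exchange; last first.
    by move=> n m; rewrite lee_fin mulr_ge0 ?ptrans_ge0// mulr_ge0 ?poisson_weight_ge0.
  under [RHS]eq_esum do rewrite mulrC.
  rewrite (esum_poisson_mean (G := fun y n => ptrans n y z))//; last first.
    by move=> y; apply: poisson_mean_ge0.
  apply: eq_esum => m _.
  under [X in (_ * X)%E]eq_esum do rewrite mulrC.
  rewrite (esum_poisson_mean (G := fun y n => ptrans n x y))//; last first.
    by move=> y; exact: ptrans_ge0.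
  rewrite -esum_scale ?poisson_weight_ge0//; last first.
    move=> n; rewrite mule_ge0 ?lee_fin ?poisson_weight_ge0//.
    by apply: esum_ge0 => y _; rewrite lee_fin mulr_ge0 ?ptrans_ge0.
  apply: eq_esum => n _; rewrite chapman_kolmogorov -!EFinM; congr EFin; ring.
- move=> x y xy; have := poisson_mean_rate (p01 x y) L0.
  rewrite [ptrans 0 x y]/ptrans /= (negPf xy) subr0 qE//.
  by under eq_cvg do rewrite subr0.
- move=> x; rewrite uniformized_exit_rate.
  have p0 : ptrans 0 x x = 1 by rewrite /ptrans /= eqxx.
  have -> : L * (1 - ptrans 1 x x) = - (L * (ptrans 1 x x - ptrans 0 x x)).
    by rewrite p0; ring.
  have /cvgN := poisson_mean_rate (p01 x x) L0.
  apply: cvg_trans; apply: near_eq_cvg.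
  by apply: nearW => h; rewrite /= -mulNr opprB eqxx.
Qed.

Theorem uniformized_ergodic : ergodic_chain q.
Proof.
have [pi [c [r [r01 pr [pi0 pi1] stat]]]] := invariant_distribution.
have p01 x y n := ptrans_01 n x y.
exists uniformized; first exact: uniformized_transition.
split.
  move=> x y; have [n xy] := irred x y; exists 1 => //.
  by apply: (poisson_mean_gt0 (p01 x y) _ xy); rewrite mulr1.
exists pi; split => //.
- move=> t y t0; under eq_esum do rewrite mulrC.
  have Lt : 0 <= L * t by rewrite mulr_ge0.
  rewrite (esum_poisson_mean (G := fun x n => ptrans n x y))//.
  transitivity (\esum_(n in [set: nat]) ((pi y)%:E * (poisson_weight (L * t) n)%:E))%E.
    apply: eq_esum => n _; rewrite muleC; congr (_ * _)%E.
    by under eq_esum do rewrite mulrC.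
  by rewrite esum_scale ?esum_poisson ?mule1// => n; rewrite lee_fin poisson_weight_ge0.
- by move=> x y; apply: (poisson_mean_cvg (p01 x y) L_gt0 r01) => n; exact: pr.
Qed.

End Uniformization.
End Harris.
End Moves.

(** * A Foster-Lyapunov criterion for jump chains *)

Section Jumps.
Context {R : realType} {S : countType} {E : finType}.
Variables (target : E -> S -> S) (rate : E -> S -> R).

Definition jumps (x y : S) : Prop := exists2 e, 0 < rate e x & y = target e x.

Definition accessible := Relation_Operators.clos_refl_trans S jumps.

(** Uniformizing at a rate above twice the total jump rate leaves a positive
    probability of staying put, which rules out periodicity; the extra [c] in
    the rate makes the discrete-time contraction factor [1 - c / L]
    nonnegative. *)
Theorem foster_lyapunov (q : S -> S -> R) (B c b : R) (V : S -> R) (z0 : S) :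
  (forall e x, 0 <= rate e x) -> (forall x, \sum_e rate e x <= B) ->
  (forall x y, x != y -> q x y = \sum_(e | y == target e x) rate e x) ->
  0 < c -> 0 < b -> (forall x, 0 <= V x) ->
  (forall x, \sum_e rate e x * (V (target e x) - V x) <= b - c * V x) ->
  (forall r, finite_set [set x | V x <= r]) ->
  (forall x y, accessible x y) -> ergodic_chain q.
Proof.
move=> rate0 rateB qE c0 b0 V0 drift finV acc.
have B0 : 0 <= B by apply: le_trans (rateB z0); apply: sumr_ge0.
pose L := 2 * B + 1 + c.
have L0 : 0 < L by rewrite /L; lra.
pose move (o : option E) x := if o is Some e then target e x else x.
pose weight (o : option E) x :=
  if o is Some e then rate e x / L else 1 - (\sum_e rate e x) / L.
have sum_option (F : option E -> R) : \sum_o F o = F None + \sum_e F (Some e).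
  rewrite (bigD1 None)//=; congr (_ + _).
  by rewrite (reindex_omap Some id) => [|[]//]; apply: eq_bigl => e; rewrite eqxx.
have none_gt0 x : 0 < weight None x.
  rewrite /weight subr_gt0 ltr_pdivrMr// mul1r; apply: le_lt_trans (rateB x) _.
  by rewrite /L; lra.
have weight0 o x : 0 <= weight o x.
  by case: o => [e|]; [rewrite divr_ge0// ltW|exact: ltW].
have weight1 x : \sum_o weight o x = 1.
  by rewrite sum_option /= -mulr_suml subrK.
have LN0 : L != 0 by rewrite gt_eqF.
have stepE f x : step move weight f x
    = f x + (\sum_e rate e x * (f (target e x) - f x)) / L.
  rewrite /step sum_option /=.
  have -> : \sum_e rate e x / L * f (target e x) =
      (\sum_e rate e x * f (target e x)) / L.
    by rewrite mulr_suml; apply: eq_bigr => e _; rewrite mulrAC.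
  have -> : \sum_e rate e x * (f (target e x) - f x) =
      \sum_e rate e x * f (target e x) - (\sum_e rate e x) * f x.
    by rewrite mulr_suml -sumrB; apply: eq_bigr => e _; rewrite mulrBr.
  by field.
have gam01 : 0 <= 1 - c / L < 1.
  by rewrite subr_ge0 ltrBlDr ltrDl divr_gt0// ler_pdivrMr// mul1r andbT /L; lra.
have driftL x : step move weight V x <= (1 - c / L) * V x + b / L.
  rewrite stepE; have := drift x; rewrite -(ler_pM2r (x := L^-1)) ?invr_gt0//.
  by lra.
apply: (@uniformized_ergodic R S _ move weight weight0 weight1 V (1 - c / L)
  (b / L) z0 V0 gam01 (divr_gt0 b0 L0) driftL finV _ _ q L L0).
- move=> x y; elim: (acc x y) => [{}x _ [e re ->]|{}x|{}x {}y z _ xy _ yz].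
  + by apply: (@reaches_move _ _ _ move weight weight0 (Some e)); rewrite /= divr_gt0.
  + exact: reaches_refl.
  + exact: reaches_trans xy yz.
- by move=> x; apply: (@ptrans_move _ _ _ move weight weight0 None).
- move=> x y xy; rewrite /ptrans /= stepE (negPf xy) add0r mulrC divfK//.
  rewrite qE// big_mkcond; apply: eq_bigr => e _.
  by rewrite subr0 eq_sym; case: eqP; rewrite ?mulr1// mulr0.
Qed.

End Jumps.

(** * Routing by the shortest of sampled queues *)

(** The draws containing [l] are those of [B] that are not draws of [B :\ l], so
    Pascal's rule counts them. *)
Lemma card_draws_mem (T : finType) (B : {set T}) (l : T) (d : nat) :
  l \in B ->
  #|[set A : {set T} | [&& A \subset B, #|A| == d.+1 & l \in A]]%SET|
    = 'C(#|B|.-1, d).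
Proof.
move=> lB; have := cards_draws B d.+1.
rewrite -(cardsID [set A : {set T} | l \in A]%SET).
have -> : ([set A : {set T} | (A \subset B) && (#|A| == d.+1)] :\:
    [set A : {set T} | l \in A] =
    [set A : {set T} | (A \subset B :\ l) && (#|A| == d.+1)])%SET.
  apply/setP => A; rewrite !inE subsetD1.
  by case: (l \in A); rewrite /= ?andbF ?andbT.
rewrite cards_draws [#|B|](cardsD1 l) lB add1n binS /= addnC => /addnI <-.
by apply: eq_card => A; rewrite !inE -andbA.
Qed.

Section Routing.
Context {R : realType} {K M N : nat} (G : system K M N) (d : nat).
Hypothesis d_gt0 : (0 < d)%N.
Implicit Types (x : @state N) (i : 'I_(ndisp G)).

Lemma route_ge0 i x j : 0 <= route d i x j :> R.
Proof.
rewrite /route; case: ifP => _; last by rewrite divr_ge0.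
by rewrite divr_ge0// sumr_ge0// => A _; rewrite divr_ge0.
Qed.

Lemma shortest_mean (f : nat -> R) x (A : {set 'I_N}) :
  (forall n, 0 <= f n) -> {homo f : m n / (m <= n)%N >-> m <= n} ->
  #|A| != 0%N ->
  \sum_j (j \in shortest x A)%:R / #|shortest x A|%:R * f (x j)
    <= (\sum_(l in A) f (x l)) / #|A|%:R.
Proof.
move=> f0 fm A0.
have A1 : 0 < #|A|%:R :> R by rewrite ltr0n lt0n.
have sum0 : 0 <= (\sum_(l in A) f (x l)) / #|A|%:R.
  by rewrite divr_ge0// sumr_ge0.
have [s0|sN0] := eqVneq #|shortest x A| 0%N.
  by rewrite big1// => j _; rewrite s0 invr0 mulr0 mul0r.
have s1 : 0 < #|shortest x A|%:R :> R by rewrite ltr0n lt0n.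
have -> : \sum_j (j \in shortest x A)%:R / #|shortest x A|%:R * f (x j)
    = (\sum_(j in shortest x A) f (x j)) / #|shortest x A|%:R.
  rewrite mulr_suml [RHS]big_mkcond; apply: eq_bigr => j _.
  by case: ifP => _; rewrite ?mul0r// mul1r mulrC.
rewrite ler_pdivrMr// mulrAC ler_pdivlMr//.
have -> : (\sum_(j in shortest x A) f (x j)) * #|A|%:R
    = \sum_(j in shortest x A) \sum_(l in A) f (x j).
  by rewrite mulr_suml; apply: eq_bigr => j _; rewrite sumr_const mulr_natr.
have -> : (\sum_(l in A) f (x l)) * #|shortest x A|%:R
    = \sum_(j in shortest x A) \sum_(l in A) f (x l).
  by rewrite sumr_const mulr_natr.
apply: ler_sum => j; rewrite inE => /andP[_ /forall_inP jmin].
by apply: ler_sum => l /jmin; exact: fm.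
Qed.

(** Joining the shortest of [d] sampled queues is, for any nondecreasing cost
    of the queue length joined, at most as costly as joining a uniformly chosen
    neighbour: each sample's minimum is at most its average, and every
    neighbour is sampled equally often. *)
Lemma route_mean (f : nat -> R) i x :
  (forall n, 0 <= f n) -> {homo f : m n / (m <= n)%N >-> m <= n} ->
  \sum_j route d i x j * f (x j) <= (\sum_(l in nbrs i) f (x l)) / (delta i)%:R.
Proof.
move=> f0 fm; rewrite /route; case: (boolP (d <= delta i)%N) => [dle|_]; last first.
  rewrite mulr_suml [leRHS]big_mkcond; apply: ler_sum => j _.
  by case: (j \in nbrs i); [rewrite mul1r mulrC|rewrite !mul0r].
have dR : 0 < d%:R :> R by rewrite ltr0n.
have delta_gt0 : (0 < delta i)%N by exact: leq_trans dle.
have C0 : 0 < 'C(delta i, d)%:R :> R by rewrite ltr0n bin_gt0.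
have -> : \sum_j (\sum_(A : {set 'I_N} | (A \subset nbrs i) && (#|A| == d))
      (j \in shortest x A)%:R / #|shortest x A|%:R) / 'C(delta i, d)%:R * f (x j)
    = (\sum_(A : {set 'I_N} | (A \subset nbrs i) && (#|A| == d))
        \sum_j (j \in shortest x A)%:R / #|shortest x A|%:R * f (x j))
      / 'C(delta i, d)%:R.
  rewrite exchange_big mulr_suml; apply: eq_bigr => j _ /=.
  by rewrite mulrAC mulr_suml.
rewrite ler_pdivrMr//.
have : \sum_(A : {set 'I_N} | (A \subset nbrs i) && (#|A| == d))
        \sum_j (j \in shortest x A)%:R / #|shortest x A|%:R * f (x j)
    <= \sum_(A : {set 'I_N} | (A \subset nbrs i) && (#|A| == d))
        \sum_(l in A) f (x l) / d%:R.
  apply: ler_sum => A /andP[_ /eqP cA]; rewrite -mulr_suml.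
  by have := @shortest_mean f x A f0 fm; rewrite cA -lt0n => /(_ d_gt0).
move/le_trans; apply.
rewrite (exchange_big_dep (mem (nbrs i)))/=; last first.
  by move=> A l /andP[/fintype.subsetP sA _] /sA.
rewrite mulr_suml mulr_suml; apply: ler_sum => l lB; rewrite sumr_const.
have -> : #|[pred A : {set 'I_N} | [&& A \subset nbrs i & #|A| == d] && (l \in A)]|
    = 'C((delta i).-1, d.-1).
  rewrite -(card_draws_mem _ lB) prednK//.
  by apply: eq_card => A; rewrite !inE -andbA.
have dl : (delta i)%:R != 0 :> R by rewrite pnatr_eq0 -lt0n.
have cE : 'C((delta i).-1, d.-1)%:R = d%:R * 'C(delta i, d)%:R / (delta i)%:R :> R.
  have := mul_bin_diag (delta i) d.-1; rewrite (prednK d_gt0) => e.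
  by rewrite -natrM -e natrM mulrC mulKf.
rewrite -[_ *+ 'C(_, _)]mulr_natr cE le_eqVlt; apply/orP; left; apply/eqP.
by field; rewrite dl gt_eqF.
Qed.

Lemma route_sum_le1 i x : \sum_j route d i x j <= 1 :> R.
Proof.
have := @route_mean (fun=> 1) i x (fun=> ler01) (fun _ _ _ => lexx _).
under eq_bigr do rewrite mulr1.
move/le_trans; apply; rewrite sumr_const -/(delta i).
have [->|dN0] := eqVneq (delta i) 0%N; first by rewrite invr0 mulr0 ler01.
by rewrite divff// pnatr_eq0.
Qed.

(** A globally shortest queue wins every sample that contains it. *)
Lemma route_gt0 i x j : edge i j -> (forall l, x j <= x l)%N ->
  0 < route d i x j :> R.
Proof.
move=> ij jmin; have jB : j \in nbrs i by rewrite inE.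
have delta_gt0 : (0 < delta i)%N by apply/card_gt0P; exists j.
rewrite /route; case: ifP => [dle|_]; last by rewrite jB divr_gt0// ltr0n.
rewrite divr_gt0 ?ltr0n ?bin_gt0//.
have : (0 < #|[set A : {set 'I_N} | [&& A \subset nbrs i, #|A| == d.-1.+1 & j \in A]]%SET|)%N.
  by rewrite card_draws_mem// bin_gt0 -ltnS !prednK.
move/card_gt0P => [A]; rewrite inE prednK// => /and3P[AB cA jA].
rewrite (bigD1 A) ?AB//= ltr_pwDl//; last first.
  by apply: sumr_ge0 => A' _; rewrite divr_ge0.
have jS : j \in shortest x A by rewrite inE jA; apply/forall_inP.
by rewrite jS divr_gt0// ltr0n; apply/card_gt0P; exists j.
Qed.

End Routing.

(** * Ergodicity of a subcritical system of fixed size *)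

Lemma finite_pos_lower (R : realFieldType) (I : finType) (f : I -> R) :
  (forall i, 0 < f i) -> exists2 c, 0 < c & forall i, c <= f i.
Proof.
move=> f0; pose g i := Num.min 1 (f i).
have g0 i : 0 < g i by rewrite lt_min ltr01 f0.
have g1 i : 0 <= g i <= 1 by rewrite ltW// ge_min lexx.
exists (\prod_i g i); first by apply: prodr_gt0.
move=> i; apply: (@le_trans _ _ (g i)); last by rewrite ge_min lexx orbT.
rewrite (bigD1 i)//= ler_piMr ?(ltW (g0 i))//.
by apply: prodr_ile1 => j _; exact: g1.
Qed.

Section FixedSize.
Context {R : realType} {K M N : nat} (G : system K M N) (d : nat).
Variables (lambda : R) (u : 'I_M -> R).
Hypothesis d_gt0 : (0 < d)%N.
Hypothesis lambda_gt0 : 0 < lambda.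
Hypothesis u_gt0 : forall m, 0 < u m.
Implicit Types (x y : @state N) (i : 'I_(ndisp G)).

Definition event : Type := ('I_(ndisp G) * 'I_N + 'I_N)%type.

Definition event_target (e : event) x : @state N :=
  match e with inl ij => incr x ij.2 | inr j => decr x j end.

Definition event_rate (e : event) x : R :=
  match e with
  | inl ij => lambda * route d ij.1 x ij.2
  | inr j => (0 < x j)%N%:R * u (stype G j)
  end.

Lemma event_rate_ge0 e x : 0 <= event_rate e x.
Proof.
by case: e => [ij|j] /=; rewrite mulr_ge0// ?route_ge0// ltW.
Qed.

Lemma sum_event (F : event -> R) :
  \sum_e F e = \sum_i \sum_j F (inl (i, j)) + \sum_j F (inr j).
Proof.
rewrite big_sumType /= (pair_bigA _ (fun i j => F (inl (i, j)))) /=.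
by congr (_ + _); apply: eq_bigr => -[].
Qed.

Lemma queue_rateE x y :
  queue_rate G d lambda u x y = \sum_(e | y == event_target e x) event_rate e x.
Proof.
rewrite big_mkcond sum_event /queue_rate; congr (_ + _).
  by apply: eq_bigr => i _; rewrite big_mkcond.
rewrite big_mkcond; apply: eq_bigr => j _ /=.
by case: (0 < x j)%N => /=; case: eqP => _; rewrite ?mul1r ?mul0r.
Qed.

Lemma event_rate_bound x :
  \sum_e event_rate e x <= \sum_(i < ndisp G) lambda + \sum_j u (stype G j).
Proof.
rewrite sum_event lerD//; apply: ler_sum.
  by move=> i _; rewrite /= -mulr_sumr ler_piMr ?(ltW lambda_gt0)// route_sum_le1.
by move=> j _ /=; case: (0 < x j)%N; rewrite ?mul1r// mul0r ltW.
Qed.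

(** ** Irreducibility *)

Hypothesis covered : forall j : 'I_N, exists i, edge (s := G) i j.

Local Notation acc := (accessible event_target event_rate).

(** Arrivals at a server with the fewest tasks are possible in every state. *)
Lemma accessible_fill x c : (forall j, x j <= c)%N -> acc x [ffun=> c].
Proof.
have [n] := ubnP (\sum_j (c - x j)); elim: n x => // n IH x /ltnSE sn xc.
have [full|] := boolP [forall j, x j == c].
  have -> : x = [ffun=> c]; last exact: Relation_Operators.rt_refl.
  by apply/ffunP => j; rewrite ffunE; exact/eqP/(forallP full).
rewrite negb_forall => /existsP[j0 xj0].
have [j _ jmin] := arg_minnP (fun l => x l) (erefl : xpredT j0).
have jc : (x j < c)%N.
  apply: (@leq_ltn_trans (x j0)); first exact: jmin.
  by rewrite ltn_neqAle xj0 xc.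
apply: (@Relation_Operators.rt_trans _ _ _ (incr x j)).
  apply: Relation_Operators.rt_step; have [i ij] := covered j.
  exists (inl (i, j)) => //=; rewrite mulr_gt0// route_gt0// => l; exact: jmin.
apply: IH => [|l]; last first.
  by rewrite ffunE; case: eqP => [->|_]; rewrite ?addn1 ?addn0.
apply: leq_trans sn; rewrite (bigD1 j)//= [X in (_ < X)%N](bigD1 j)//=.
rewrite ffunE eqxx addn1 -addSn leq_add//; first by rewrite subnS prednK// subn_gt0.
by apply: leq_sum => l /negPf lj; rewrite ffunE lj addn0.
Qed.

Lemma accessible_serve x y : (forall j, y j <= x j)%N -> acc x y.
Proof.
have [n] := ubnP (\sum_j (x j - y j)); elim: n x => // n IH x /ltnSE sn yx.
have [full|] := boolP [forall j, x j == y j].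
  have -> : x = y; last exact: Relation_Operators.rt_refl.
  by apply/ffunP => j; exact/eqP/(forallP full).
rewrite negb_forall => /existsP[j xj].
have yj : (y j < x j)%N by rewrite ltn_neqAle eq_sym xj yx.
apply: (@Relation_Operators.rt_trans _ _ _ (decr x j)).
  apply: Relation_Operators.rt_step; exists (inr j) => //=.
  by rewrite (leq_ltn_trans _ yj)// mul1r.
apply: IH => [|l]; last first.
  by rewrite ffunE; case: eqP => [->|_]; rewrite ?subn0// subn1 -ltnS prednK// (leq_ltn_trans _ yj).
apply: leq_trans sn; rewrite (bigD1 j)//= [X in (_ < X)%N](bigD1 j)//=.
rewrite ffunE eqxx subn1 -addSn leq_add//; first by rewrite -subn1 subnAC subn1 ltn_predL subn_gt0.
by apply: leq_sum => l /negPf lj; rewrite ffunE lj subn0.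
Qed.

(** Joining the shortest queue does not allow arbitrary arrivals; but all
    queues can be levelled from below and then served down. *)
Lemma accessible_queue x y : acc x y.
Proof.
pose c := (\max_j x j + \max_j y j)%N.
apply: (@Relation_Operators.rt_trans _ _ _ [ffun=> c]).
  by apply: accessible_fill => j; rewrite (leq_trans (leq_bigmax j))// leq_addr.
apply: accessible_serve => j.
by rewrite ffunE (leq_trans (leq_bigmax j))// leq_addl.
Qed.

(** ** Drift of the exponential Lyapunov function *)

Hypothesis subcritical : forall j : 'I_N,
  lambda * \sum_(i | edge (s := G) i j) (delta i)%:R^-1 < u (stype G j).

(** An exponential function, unlike a quadratic one, has a drift proportional to
    itself, as the geometric contraction requires. *)
Definition lyapunov (z : R) x : R := \sum_j z ^+ x j.

Lemma lyapunov_incr z x j :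
  lyapunov z (incr x j) - lyapunov z x = (z - 1) * z ^+ x j.
Proof.
rewrite /lyapunov -sumrB (bigD1 j)//= big1 ?addr0 => [|l /negPf lj].
  by rewrite ffunE eqxx addn1 exprS; ring.
by rewrite ffunE lj addn0 subrr.
Qed.

Lemma lyapunov_decr z x j : z != 0 -> (0 < x j)%N ->
  lyapunov z (decr x j) - lyapunov z x = - ((z - 1) / z * z ^+ x j).
Proof.
move=> z0 xj; rewrite /lyapunov -sumrB (bigD1 j)//= big1 ?addr0 => [|l /negPf lj].
  by rewrite ffunE eqxx subn1 -{2 3}(prednK xj) exprS; field.
by rewrite ffunE lj subn0 subrr.
Qed.

(** Exponentials bound every queue length on a sublevel set, which is therefore
    in the image of a finite box. *)
Lemma lyapunov_finite z r : 1 < z -> finite_set [set x | lyapunov z x <= r].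
Proof.
move=> z1; have z0 : 0 <= z by rewrite (le_trans ler01)// ltW.
have [n rn] : exists n : nat, r < z ^+ n.
  have e0 : 0 < z - 1 by rewrite subr_gt0.
  pose n := Num.bound (`|r| / (z - 1)); exists n.
  have bern m : 1 + m%:R * (z - 1) <= z ^+ m.
    elim: m => [|m IH]; first by rewrite mul0r addr0 expr0.
    have := ler_wpM2l z0 IH; rewrite -exprS => /(le_trans _); apply.
    have : 0 <= m%:R * (z - 1) ^+ 2 by rewrite mulr_ge0// exprn_ge0// ltW.
    by rewrite -natr1; nra.
  apply: lt_le_trans (bern n).
  have : `|r| / (z - 1) < n%:R by apply: archi_boundP; rewrite divr_ge0// ltW.
  rewrite ltr_pdivrMr// => /(le_lt_trans (ler_norm r)); lra.
pose embed (g : {ffun 'I_N -> 'I_n}) : @state N := [ffun j => g j : nat].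
apply: (@sub_finite_set _ _ (range embed)); last exact: finite_image.
move=> x /= xr.
have xn j : (x j < n)%N.
  rewrite ltnNge; apply/negP => nx.
  have : z ^+ n <= r; last by rewrite leNgt rn.
  apply: le_trans xr; apply: (@le_trans _ _ (z ^+ x j)).
    by rewrite ler_weXn2l// ltW.
  by rewrite /lyapunov (bigD1 j)//= lerDl sumr_ge0// => l _; rewrite exprn_ge0.
exists [ffun j => Ordinal (xn j)] => //; apply/ffunP => j.
by rewrite !ffunE.
Qed.

(** Up to a constant, which makes up for the idle servers, a queue [j] of type
    [m] contributes at most [(z - 1) * (a j - u m / z) * z ^+ x j] to the drift,
    [a j] being its load under uniform routing; the coefficient is negative once
    [z] is so close to [1] that [a j * z < u m]. *)
Lemma lyapunov_drift : exists (z c : R), [/\ 1 < z, 0 < c & forall x,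
  \sum_e event_rate e x * (lyapunov z (event_target e x) - lyapunov z x)
    <= (\sum_j u (stype G j) + 1) - c * lyapunov z x].
Proof.
pose a j := lambda * \sum_(i | edge (s := G) i j) (delta i)%:R^-1.
have a0 j : 0 <= a j by rewrite mulr_ge0 ?(ltW lambda_gt0)// sumr_ge0.
have [eta eta0 etaP] : exists2 eta, 0 < eta & forall j,
    eta <= (u (stype G j) - a j) / (a j + 1).
  apply: finite_pos_lower => j; apply: divr_gt0; last by rewrite ltr_wpDl.
  by rewrite subr_gt0; exact: subcritical.
pose z := 1 + eta.
have z1 : 1 < z by rewrite ltrDl.
have z0 : 0 < z by exact: lt_trans z1.
have za j : 0 < (z - 1) * (u (stype G j) / z - a j).
  rewrite mulr_gt0 ?subr_gt0// ltr_pdivlMr//.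
  have := etaP j; rewrite ler_pdivlMr ?ltr_wpDl// /z.
  by have := a0 j; nra.
have [c c0 cP] := finite_pos_lower za.
exists z, c; split => // x; rewrite sum_event /=.
have f_homo : {homo (fun n => z ^+ n) : m n / (m <= n)%N >-> m <= n}.
  by move=> m n mn; rewrite ler_weXn2l// ltW.
have arrivals : \sum_(i < ndisp G) \sum_j lambda * route d i x j *
      (lyapunov z (incr x j) - lyapunov z x)
    <= \sum_j (z - 1) * a j * z ^+ x j.
  have -> : \sum_j (z - 1) * a j * z ^+ x j = \sum_(i < ndisp G) (lambda * (z - 1)) *
      ((\sum_(l in nbrs i) z ^+ x l) / (delta i)%:R).
    transitivity (\sum_j \sum_i (if edge (s := G) i j then
        (lambda * (z - 1)) * (z ^+ x j / (delta i)%:R) else 0)).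
      apply: eq_bigr => j _; rewrite /a -big_mkcond mulrA mulr_sumr mulr_suml.
      by apply: eq_bigr => i _; rewrite mulrCA mulrA; ring.
    rewrite exchange_big; apply: eq_bigr => i _.
    rewrite mulr_suml mulr_sumr [RHS]big_mkcond; apply: eq_bigr => j _.
    by rewrite inE; case: ifP.
  apply: ler_sum => i _.
  have -> : \sum_j lambda * route d i x j *
        (lyapunov z (incr x j) - lyapunov z x)
      = lambda * (z - 1) * \sum_j route d i x j * z ^+ x j.
    by rewrite mulr_sumr; apply: eq_bigr => j _; rewrite lyapunov_incr; ring.
  apply: ler_wpM2l; first by apply: mulr_ge0; rewrite ?subr_ge0 ltW.
  by apply: (route_mean d_gt0 (f := GRing.exp z)) => // n; rewrite exprn_ge0// ltW.
have services : \sum_j (0 < x j)%N%:R * u (stype G j) *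
      (lyapunov z (decr x j) - lyapunov z x)
    <= \sum_j (u (stype G j) - (z - 1) * (u (stype G j) / z) * z ^+ x j).
  apply: ler_sum => j _; have u0 := u_gt0 (stype G j).
  have [xj|] := ltnP 0 (x j).
    rewrite lyapunov_decr ?gt_eqF// mul1r -subr_ge0.
    by rewrite (_ : _ - _ = u (stype G j)); [exact: ltW|ring].
  rewrite leqn0 => /eqP ->; rewrite !mul0r expr0 mulr1 subr_ge0.
  rewrite mulrCA ler_piMr ?(ltW u0)// ler_pdivrMr// mul1r lerBlDr lerDl ler01//.
apply: (le_trans (lerD arrivals services)).
rewrite -big_split /=.
apply: (@le_trans _ _ (\sum_j (u (stype G j) - c * z ^+ x j))).
  apply: ler_sum => j _.
  have : c * z ^+ x j <= (z - 1) * (u (stype G j) / z - a j) * z ^+ x j.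
    by rewrite ler_wpM2r// exprn_ge0// ltW.
  by rewrite mulrBr mulrBl; lra.
by rewrite sumrB -mulr_sumr /lyapunov; lra.
Qed.

Theorem subcritical_ergodic : ergodic_chain (queue_rate G d lambda u).
Proof.
have [z [c [z1 c0 driftP]]] := lyapunov_drift.
have sum_u0 : 0 <= \sum_j u (stype G j) by apply: sumr_ge0 => j _; rewrite ltW.
apply: (@foster_lyapunov R (@state N) _ event_target event_rate _
  (\sum_(i < ndisp G) lambda + \sum_j u (stype G j)) c
  (\sum_j u (stype G j) + 1) (lyapunov z) [ffun=> 0%N]).
- exact: event_rate_ge0.
- exact: event_rate_bound.
- by move=> x y _; exact: queue_rateE.
- exact: c0.
- by rewrite ltr_wpDl.
- by move=> x; apply: sumr_ge0 => j _; rewrite exprn_ge0// ltW// (lt_trans ltr01).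
- exact: driftP.
- by move=> r; exact: lyapunov_finite.
- exact: accessible_queue.
Qed.

End FixedSize.

(** * Degrees and loads *)

Section Degrees.
Context {K M N : nat} (G : system K M N).

Lemma min_over_le (I : finType) (A : {set I}) (f : I -> nat) i :
  i \in A -> (min_over A f <= f i)%N.
Proof.
move=> iA; rewrite /min_over; have := mem_index_enum i.
elim: (index_enum I) => //= a s IH; rewrite inE big_cons => /orP[/eqP <-|/IH].
  by rewrite iA geq_minl.
by case: ifP => // _; apply: leq_trans; exact: geq_minr.
Qed.

Lemma le_max_over (I : finType) (A : {set I}) (f : I -> nat) i :
  i \in A -> (f i <= max_over A f)%N.
Proof. by move=> iA; exact: (leq_bigmax_cond (F := f)). Qed.

Local Notation maxw k m := (max_over (dispatchers G k) (fun i => deg_w i m)).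
Local Notation minw k m := (min_over (dispatchers G k) (fun i => deg_w i m)).
Local Notation maxv k m := (max_over (servers G m) (fun j => deg_v G k j)).
Local Notation minv k m := (min_over (servers G m) (fun j => deg_v G k j)).

Lemma edges_between_deg_v k m :
  edges_between G k m = (\sum_(j in servers G m) deg_v G k j)%N.
Proof.
rewrite /edges_between -sum1_card.
under [RHS]eq_bigr do rewrite /deg_v -sum1_card.
rewrite (exchange_big_dep (mem (dispatchers G k)))/=; last first.
  by move=> j i _; rewrite inE => /andP[].
rewrite pair_big_dep/=; apply: eq_bigl => -[i j] /=; rewrite !inE /=.
by case: (dtype i == k); rewrite ?andbF.
Qed.

Lemma edges_between_deg_w k m :
  edges_between G k m = (\sum_(i in dispatchers G k) deg_w i m)%N.
Proof.
rewrite /edges_between -sum1_card.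
under [RHS]eq_bigr do rewrite /deg_w -sum1_card.
by rewrite pair_big_dep/=; apply: eq_bigl => -[i j] /=; rewrite !inE.
Qed.

Lemma min_deg_v_le_edges k m :
  (#|servers G m| * minv k m <= edges_between G k m)%N.
Proof.
by rewrite edges_between_deg_v -sum_nat_const; apply: leq_sum => j; exact: min_over_le.
Qed.

Lemma edges_le_max_deg_w k m :
  (edges_between G k m <= #|dispatchers G k| * maxw k m)%N.
Proof.
rewrite edges_between_deg_w -sum_nat_const; apply: leq_sum => i iW.
exact: (le_max_over (fun i => deg_w i m)).
Qed.

Lemma delta_sum_deg_w (i : 'I_(ndisp G)) : delta i = (\sum_m deg_w i m)%N.
Proof.
rewrite /delta -sum1_card (partition_big (stype G) xpredT)//=.
apply: eq_bigr => m _; rewrite /deg_w -sum1_card; apply: eq_bigl => j.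
by rewrite !inE andbC.
Qed.

(** At most [maxv k m] neighbours of a type-[m] server have type [k], and each
    of them has at least [\sum_l minw k l] neighbours among which it shares its
    tasks. *)
Lemma load_le (R : realFieldType) (j : 'I_N) :
  (forall k, 0 < \sum_l minw k l)%N ->
  \sum_(i | edge (s := G) i j) (delta i)%:R^-1
    <= \sum_k (maxv k (stype G j))%:R / (\sum_l (minw k l)%:R) :> R.
Proof.
move=> D0; rewrite (partition_big (@dtype _ _ _ G) xpredT)//=.
apply: ler_sum => k _.
have Dk : 0 < \sum_l (minw k l)%:R :> R by rewrite -natr_sum ltr0n.
apply: (@le_trans _ _ (\sum_(i | edge i j && (dtype i == k))
    (\sum_l (minw k l)%:R)^-1)).
  apply: ler_sum => i /andP[_ ik]; rewrite lef_pV2 ?posrE//; last first.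
    apply: lt_le_trans Dk _; rewrite delta_sum_deg_w natr_sum.
    apply: ler_sum => l _; rewrite ler_nat.
    by apply: (min_over_le (fun i => deg_w i l)); rewrite inE.
  rewrite delta_sum_deg_w natr_sum; apply: ler_sum => l _; rewrite ler_nat.
  by apply: (min_over_le (fun i => deg_w i l)); rewrite inE.
rewrite sumr_const -[_ *+ _]mulr_natl ler_pM2r ?invr_gt0// ler_nat.
apply: leq_trans (le_max_over (fun j => deg_v G k j) _); last first.
  by rewrite inE.
rewrite /deg_v; apply: eq_leq; apply: eq_card => i.
by rewrite !inE andbC.
Qed.

(** The mean degree is at least the minimal one, so the maximal degree is at
    most the mean times the ratio of extremes. The factors on the right are the
    quantities whose limits are known. *)
Lemma max_deg_v_bound (R : realFieldType) k m :
  (0 < minv k m)%N -> (0 < #|servers G m|)%N -> (0 < #|dispatchers G k|)%N ->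
  (0 < ndisp G)%N -> (0 < N)%N ->
  (maxv k m)%:R / N%:R <= (maxv k m)%:R / (minv k m)%:R
    * ((edges_between G k m)%:R / (#|dispatchers G k|%:R * #|servers G m|%:R))
    * (#|dispatchers G k|%:R / (ndisp G)%:R) * ((ndisp G)%:R / N%:R) :> R.
Proof.
move=> mv V0 W0 n0 N0; have := min_deg_v_le_edges k m.
rewrite -(ler_nat R) natrM.
rewrite -(ltr0n R) in mv; rewrite -(ltr0n R) in V0; rewrite -(ltr0n R) in W0.
rewrite -(ltr0n R) in n0; rewrite -(ltr0n R) in N0.
move: (maxv k m)%:R (ler0n R (maxv k m)) => x x0.
move: (minv k m)%:R mv => y y0; move: (edges_between G k m)%:R => e ye.
move: #|servers G m|%:R V0 ye => a a0 ye; move: #|dispatchers G k|%:R W0 => b b0.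
move: (ndisp G)%:R n0 => n n0; move: N%:R N0 => r r0.
have -> : x / y * (e / (b * a)) * (b / n) * (n / r) = x / r * (e / (a * y)).
  by field; rewrite !gt_eqF.
by rewrite ler_peMr ?divr_ge0 ?(ltW r0)// ler_pdivlMr ?mulr_gt0// mul1r.
Qed.

Lemma min_deg_w_bound (R : realFieldType) k m :
  (0 < minw k m)%N -> (0 < maxw k m)%N ->
  (0 < #|servers G m|)%N -> (0 < #|dispatchers G k|)%N -> (0 < N)%N ->
  ((maxw k m)%:R / (minw k m)%:R)^-1
    * ((edges_between G k m)%:R / (#|dispatchers G k|%:R * #|servers G m|%:R))
    * (#|servers G m|%:R / N%:R) <= (minw k m)%:R / N%:R :> R.
Proof.
move=> mw Mw V0 W0 N0; have := edges_le_max_deg_w k m.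
rewrite -(ler_nat R) natrM.
rewrite -(ltr0n R) in mw; rewrite -(ltr0n R) in Mw; rewrite -(ltr0n R) in V0.
rewrite -(ltr0n R) in W0; rewrite -(ltr0n R) in N0.
move: (maxw k m)%:R Mw => x x0.
move: (minw k m)%:R mw => y y0; move: (edges_between G k m)%:R => e ex.
move: #|servers G m|%:R V0 => a a0; move: #|dispatchers G k|%:R W0 ex => b b0 ex.
move: N%:R N0 => r r0.
have -> : (x / y)^-1 * (e / (b * a)) * (a / r) = y / r * (e / (b * x)).
  by field; rewrite !gt_eqF.
by rewrite ler_piMr ?divr_ge0 ?(ltW r0) ?(ltW y0)// ler_pdivrMr ?mulr_gt0// mul1r.
Qed.

End Degrees.

Section Asymptotics.
Context {R : realType} {K M : nat}.
Variables (G : forall N, system K M N) (lambda xi : R) (w : 'I_K -> R)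
  (v u : 'I_M -> R) (p : 'M[R]_(K, M)).
Hypothesis K_gt0 : (0 < K)%N.
Hypothesis lambda_gt0 : 0 < lambda.
Hypothesis xi_gt0 : 0 < xi.
Hypothesis w_gt0 : forall k, 0 < w k.
Hypothesis v_gt0 : forall m, 0 < v m.
Hypothesis GT : type_proportions G xi w v.
Hypothesis GC : conditionC G p.
Hypothesis GL : load_inequalities lambda xi w v u p.

Local Notation maxw N k m := (max_over (dispatchers (G N) k) (fun i => deg_w i m)).
Local Notation minw N k m := (min_over (dispatchers (G N) k) (fun i => deg_w i m)).
Local Notation maxv N k m := (max_over (servers (G N) m) (fun j => deg_v (G N) k j)).
Local Notation minv N k m := (min_over (servers (G N) m) (fun j => deg_v (G N) k j)).

Let density N k m : R := (edges_between (G N) k m)%:R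
  / (#|dispatchers (G N) k|%:R * #|servers (G N) m|%:R).

(** Positive limits of ratios exclude zero counts, both above and below. *)
Lemma ratio_gt0 (f g : nat -> nat) (l : R) : 0 < l ->
  (f N)%:R / (g N)%:R @[N --> \oo] --> l ->
  \forall N \near \oo, (0 < f N)%N && (0 < g N)%N.
Proof.
move=> l0 fg; have /(_ _ 0 l0) := cvgr_gt _ fg; apply: filterS => N.
rewrite !lt0n; case: (f N) => [|a]; first by rewrite mul0r ltxx.
by case: (g N) => [|b]//; rewrite invr0 mulr0 ltxx.
Qed.

Lemma eventually_nondegenerate : \forall N \near \oo,
  [/\ (0 < ndisp (G N))%N, (0 < N)%N,
      forall k, (0 < #|dispatchers (G N) k|)%N,
      forall m, (0 < #|servers (G N) m|)%N &
      forall km : 'I_K * 'I_M, [/\ (0 < minw N km.1 km.2)%N,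
        (0 < maxw N km.1 km.2)%N & (0 < minv N km.1 km.2)%N]].
Proof.
have [Gn Gw Gv] := GT; have [_ Gd] := GC.
have hn := ratio_gt0 xi_gt0 Gn.
have hw : \forall N \near \oo, forall k, (0 < #|dispatchers (G N) k|)%N && (0 < ndisp (G N))%N.
  by apply: filter_forall => k; exact: ratio_gt0 (w_gt0 k) (Gw k).
have hv : \forall N \near \oo, forall m, (0 < #|servers (G N) m|)%N && (0 < N)%N.
  by apply: filter_forall => m; exact: (ratio_gt0 (g := id) (v_gt0 m) (Gv m)).
have hdw : \forall N \near \oo, forall km : 'I_K * 'I_M,
    (0 < maxw N km.1 km.2)%N && (0 < minw N km.1 km.2)%N.
  by apply: filter_forall => -[k m]; exact: ratio_gt0 ltr01 (Gd k m).1.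
have hdv : \forall N \near \oo, forall km : 'I_K * 'I_M,
    (0 < maxv N km.1 km.2)%N && (0 < minv N km.1 km.2)%N.
  by apply: filter_forall => -[k m]; exact: ratio_gt0 ltr01 (Gd k m).2.
near=> N.
have /andP[n0 N0] : (0 < ndisp (G N))%N && (0 < N)%N by near: N.
split=> //.
- move=> k; have /(_ k)/andP[] // : forall k,
    (0 < #|dispatchers (G N) k|)%N && (0 < ndisp (G N))%N by near: N.
- move=> m; have /(_ m)/andP[] // : forall m,
    (0 < #|servers (G N) m|)%N && (0 < N)%N by near: N.
- move=> km.
  have /(_ km)/andP[? ?] : forall km : 'I_K * 'I_M,
    (0 < maxw N km.1 km.2)%N && (0 < minw N km.1 km.2)%N by near: N.
  have /(_ km)/andP[? ?] : forall km : 'I_K * 'I_M,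
    (0 < maxv N km.1 km.2)%N && (0 < minv N km.1 km.2)%N by near: N.
  by split.
Unshelve. all: by end_near.
Qed.

Let upper N k m : R := (maxv N k m)%:R / (minv N k m)%:R * density N k m
  * (#|dispatchers (G N) k|%:R / (ndisp (G N))%:R) * ((ndisp (G N))%:R / N%:R).

Let lower N k m : R := ((maxw N k m)%:R / (minw N k m)%:R)^-1 * density N k m
  * (#|servers (G N) m|%:R / N%:R).

Lemma upper_cvg k m : upper N k m @[N --> \oo] --> p k m * w k * xi.
Proof.
have [Gn Gw _] := GT; have [Ge Gd] := GC.
rewrite -[p k m]mul1r; apply: cvgM Gn; apply: cvgM (Gw k).
by apply: cvgM (Ge k m); have [] := Gd k m.
Qed.

Lemma lower_cvg k m : lower N k m @[N --> \oo] --> p k m * v m.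
Proof.
have [_ _ Gv] := GT; have [Ge Gd] := GC.
rewrite -[p k m]mul1r -[1]invr1; apply: cvgM (Gv m).
apply: cvgM (Ge k m); apply: cvgV; first exact: oner_neq0.
by have [] := Gd k m.
Qed.

Lemma sum_lower_cvg k :
  \sum_l lower N k l @[N --> \oo] --> \sum_l p k l * v l.
Proof. by apply: cvg_big => [|l _]; [exact: add_continuous|exact: lower_cvg]. Qed.

Lemma eventually_sum_lower_gt0 :
  \forall N \near \oo, forall k, 0 < \sum_l lower N k l.
Proof.
have [GL1 _] := GL; apply: filter_forall => k.
by have /(_ _ 0 (GL1 k)) := cvgr_gt _ (sum_lower_cvg (k := k)).
Qed.

Lemma eventually_load_lt : \forall N \near \oo, forall m,
  lambda * \sum_k upper N k m / \sum_l lower N k l < u m.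
Proof.
have [GL1 GL2] := GL; apply: filter_forall => m.
apply: (cvgr_lt (lambda * xi * \sum_k w k * p k m / \sum_l p k l * v l)); last exact: GL2.
have -> : lambda * xi * \sum_k w k * p k m / \sum_l p k l * v l =
    lambda * \sum_k p k m * w k * xi / \sum_l p k l * v l.
  by rewrite -mulrA !mulr_sumr; apply: eq_bigr => k _; ring.
apply: cvgM; first exact: cvg_cst.
apply: cvg_big => [|k _]; first exact: add_continuous.
apply: cvgM; first exact: upper_cvg.
by apply: cvgV; [rewrite gt_eqF|exact: sum_lower_cvg].
Qed.

Lemma eventually_subcritical : \forall N \near \oo,
  (forall j : 'I_N, exists i, edge (s := G N) i j) /\
  (forall j : 'I_N, lambda * \sum_(i | edge (s := G N) i j) (delta i)%:R^-1
     < u (stype (G N) j)).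
Proof.
near=> N.
have [n0 N0 W0 V0 D0] : [/\ (0 < ndisp (G N))%N, (0 < N)%N,
      forall k, (0 < #|dispatchers (G N) k|)%N,
      forall m, (0 < #|servers (G N) m|)%N &
      forall km : 'I_K * 'I_M, [/\ (0 < minw N km.1 km.2)%N,
        (0 < maxw N km.1 km.2)%N & (0 < minv N km.1 km.2)%N]].
  by near: N; exact: eventually_nondegenerate.
have L0 : forall k, 0 < \sum_l lower N k l.
  by near: N; exact: eventually_sum_lower_gt0.
have load : forall m, lambda * \sum_k upper N k m / \sum_l lower N k l < u m.
  by near: N; exact: eventually_load_lt.
have NR : 0 < N%:R :> R by rewrite ltr0n.
split=> j.
  have [_ _ mv] := D0 (Ordinal K_gt0, stype (G N) j).
  have : (0 < deg_v (G N) (Ordinal K_gt0) j)%N.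
    by apply: leq_trans mv (min_over_le _ _); rewrite inE.
  by case/card_gt0P => i; rewrite inE => /andP[_ ij]; exists i.
apply: le_lt_trans (load (stype (G N) j)); rewrite ler_pM2l//.
have minw_sum k : (0 < \sum_l minw N k l)%N.
  rewrite (bigD1 (stype (G N) j))//= addn_gt0.
  by have [-> _ _] := D0 (k, stype (G N) j).
apply: (le_trans (load_le R j minw_sum)); apply: ler_sum => k _.
have [_ _ mv] := D0 (k, stype (G N) j).
have up := max_deg_v_bound R mv (V0 _) (W0 _) n0 N0.
have low : \sum_l lower N k l <= (\sum_l (minw N k l)%:R) / N%:R.
  rewrite mulr_suml; apply: ler_sum => l _; have [mw Mw _] := D0 (k, l).
  exact: min_deg_w_bound.
have S0 : 0 < \sum_l (minw N k l)%:R :> R by rewrite -natr_sum ltr0n.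
have -> : (maxv N k (stype (G N) j))%:R / \sum_l (minw N k l)%:R
    = (maxv N k (stype (G N) j))%:R / N%:R / ((\sum_l (minw N k l)%:R) / N%:R) :> R.
  by field; rewrite !gt_eqF.
apply: ler_pM => //; first by rewrite invr_ge0 divr_ge0// ltW.
by rewrite lef_pV2// posrE// divr_gt0.
Unshelve. all: by end_near.
Qed.

End Asymptotics.

(** Connecting every dispatcher to type-[m] servers with density proportional
    to their speed [u m] shares the load in proportion to the capacity. *)
Lemma load_inequalities_solvable (R : realType) (K M : nat) (lambda xi : R)
    (w : 'I_K -> R) (v u : 'I_M -> R) :
  (0 < M)%N -> (forall m, 0 < u m) -> \sum_(k < K) w k = 1 ->
  (forall m, 0 < v m) -> lambda * xi < \sum_(m < M) u m * v m ->
  exists p : 'M[R]_(K, M),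
    unit_entries p /\ load_inequalities lambda xi w v u p.
Proof.
move=> M0 u0 w1 v0 load; pose U := \sum_m u m.
have uU m : u m <= U by rewrite /U (bigD1 m)//= lerDl sumr_ge0// => l _; exact: ltW.
have U0 : 0 < U by exact: lt_le_trans (u0 (Ordinal M0)) (uU _).
have uv0 : 0 < \sum_m u m * v m.
  rewrite (bigD1 (Ordinal M0))//= ltr_pwDl ?mulr_gt0// sumr_ge0// => l _.
  by rewrite mulr_ge0// ltW.
exists (\matrix_(k, m) (u m / U)); split.
  by move=> k m; rewrite mxE divr_ge0 ?(ltW (u0 m)) ?(ltW U0)//= ler_pdivrMr// mul1r.
have sumE k : \sum_l (\matrix_(k < K, m < M) (u m / U)) k l * v l
    = (\sum_l u l * v l) / U.
  by rewrite mulr_suml; apply: eq_bigr => l _; rewrite mxE mulrAC.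
split=> [k|m]; first by rewrite sumE divr_gt0.
have -> : \sum_(k < K) w k * (\matrix_(k < K, m < M) (u m / U)) k m
      / (\sum_l (\matrix_(k < K, m < M) (u m / U)) k l * v l)
    = u m / \sum_l u l * v l.
  rewrite -[RHS]mul1r -w1 mulr_suml; apply: eq_bigr => k _.
  by rewrite sumE mxE; field; rewrite !gt_eqF.
by rewrite mulrA ltr_pdivrMr// mulrC ltr_pM2l.
Qed.

Theorem proposition3p3 (R : realType) (K M d : nat) (lambda xi : R)
    (w : 'I_K -> R) (v u : 'I_M -> R)
    (hK : (1 <= K)%N) (hM : (1 <= M)%N) (hd : (2 <= d)%N)
    (hlambda : 0 < lambda) (hxi : 0 < xi) (hu : forall m, 0 < u m)
    (hw : forall k, 0 < w k <= 1) (hw1 : \sum_(k < K) w k = 1)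
    (hv : forall m, 0 < v m <= 1) (hv1 : \sum_(m < M) v m = 1)
    (hload : lambda * xi < \sum_(m < M) u m * v m) :
  (exists p : 'M[R]_(K, M),
      unit_entries p /\ eventually_ergodic d lambda xi w v u p) /\
  (exists p : 'M[R]_(K, M),
      unit_entries p /\ load_inequalities lambda xi w v u p) /\
  (forall p : 'M[R]_(K, M),
      unit_entries p -> load_inequalities lambda xi w v u p ->
      eventually_ergodic d lambda xi w v u p).
Proof.
have w0 k : 0 < w k by have /andP[] := hw k.
have v0 m : 0 < v m by have /andP[] := hv m.
have ergodic (p : 'M[R]_(K, M)) : load_inequalities lambda xi w v u p ->
    eventually_ergodic d lambda xi w v u p.
  move=> pL G GT GC.
  apply: filterS (eventually_subcritical hK hlambda hxi w0 v0 GT GC pL) => N [].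
  exact: subcritical_ergodic (ltnW hd) hlambda hu.
have [p [p01 pL]] := load_inequalities_solvable hM hu hw1 v0 hload.
split; first by exists p; split => //; exact: ergodic.
by split; [exists p|move=> p' _; exact: ergodic].
Qed.
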